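(* The tangent cone $TC_{P_5}W_{KLM}^9$ to $W_{KLM}^9\subset\mathbb{P}^9$ at the point $P_5$ is a cone over a reducible sextic surface $M_6\subset\mathbb{P}^7\subset\mathbb{P}^9$, which is given by the union of four planes $\pi_1,\pi_2,\pi_1',\pi_2'$ and a quadric surface $Q\subset\mathbb{P}^3\subset\mathbb{P}^7$. In particular, the planes $\pi_1,\pi_2,\pi_1',\pi_2'$ intersect the quadric surface $Q$ along lines $l_1,l_2,l_1',l_2'$ respectively, where $l_i$ is disjoint from $l_i'$ for $i=1,2$. In the other cases the intersections of two of these lines identify four points, which are $q_{1,2}:=l_1\cap l_2$, $q_{1,2'}:=l_1\cap l_2'$, $q_{1',2}:=l_1'\cap l_2$, $q_{1',2'}:=l_1'\cap l_2'$.
   Context: We work over $\mathbb{C}$. Let $W_F^{13}\subset\mathbb{P}^{13}_{[w_0:\dots:w_{13}]}$ be the closure of the image of the rational map on $\mathbb{P}^3_{[t_0:\dots:t_3]}$ defined by the sextic surfaces having double points along the six edges of the tetrahedron $\{t_0t_1t_2t_3=0\}$, i.e. given by $w_0=t_0t_1^3t_2t_3$, $w_1=t_0^2t_1^2t_2^2$, $w_2=t_0^2t_1^2t_2t_3$, $w_3=t_0^2t_1^2t_3^2$, $w_4=t_0^3t_1t_2t_3$, $w_5=t_0t_1^2t_2^2t_3$, $w_6=t_0t_1^2t_2t_3^2$, $w_7=t_0^2t_1t_2^2t_3$, $w_8=t_0^2t_1t_2t_3^2$, $w_9=t_1^2t_2^2t_3^2$, $w_{10}=t_0t_1t_2^3t_3$,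 $w_{11}=t_0t_1t_2^2t_3^2$, $w_{12}=t_0t_1t_2t_3^3$, $w_{13}=t_0^2t_2^2t_3^2$. It has eight quadruple points, namely the coordinate points with only nonzero coordinate $w_k$, $k\in\{0,1,3,4,9,10,12,13\}$. Fix a general hyperplane $H_{12}=\{\sum_{i=0}^{13}a_iw_i=0\}$ with $a_0=1$ and $a_1,a_3,a_4,a_9,a_{10},a_{12},a_{13}\ne0$. Let $E_3$ be the elliptic quartic curve cut out on $W_F^{13}$ by $w_0+a_1w_1+a_2w_2+a_3w_3+a_4w_4=w_5=\dots=w_{13}=0$. The KLM-EF 3-fold $W_{KLM}^9\subset\mathbb{P}^9_{[z_0:\dots:z_9]}$ is the (closure of the) image of $W_F^{13}$ under the projection from $\langle E_3\rangle\cong\mathbb{P}^3$, given by $[w_0:\dots:w_{13}]\mapsto[w_0+a_1w_1+a_2w_2+a_3w_3+a_4w_4:w_5:w_6:w_7:w_8:w_9:w_{10}:w_{11}:w_{12}:w_{13}]$. The point $P_5\in W_{KLM}^9$ is the coordinate point of $\mathbb{P}^9$ with only nonzero coordinate $z_0$; it is the common image of the four quadruple points of $W_F^{13}$ with only nonzero coordinate $w_0$, $w_1$, $w_3$, $w_4$. *)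

(* Defs.v *)
(* MathComp, with multinomials for polynomials, real-closed for the complex
   numbers R[i], and classical_sets for sets of points and of polynomials. *)
From HB Require Import structures.
From mathcomp Require Export all_boot all_order all_algebra.
From mathcomp Require Export complex classical_sets reals.
From mathcomp Require Export mpoly.

Set Implicit Arguments.
Unset Strict Implicit.
Unset Printing Implicit Defensive.

Import Order.TTheory GRing.Theory Num.Theory.

Local Open Scope ring_scope.
Local Open Scope classical_set_scope.

(* A subset of P^n is represented by the set of all the nonzero vectors of
   K^(n+1) (row vectors) that are homogeneous coordinates of one of its points.
   All the constructions of subsets of P^n below produce sets of nonzero
   vectors that are stable under nonzero scaling, so that equality, inclusion,
   union and intersection of such sets are those of subsets of P^n. *)

Section ProjectiveGeometry.
Variables (K : fieldType) (n : nat).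
Implicit Types (X Y : set 'rV[K]_n.+1) (p v : 'rV[K]_n.+1).
Implicit Types (I : set {mpoly K[n.+1]}) (F G : {mpoly K[n.+1]}).

Definition eval_at F v : K := F.@[fun i => v 0 i].

Definition pspace : set 'rV[K]_n.+1 := [set v | v != 0].

Definition plinear (V : {vspace 'rV[K]_n.+1}) : set 'rV[K]_n.+1 :=
  [set v | v != 0 /\ v \in V].

(* As X is stable under scaling, this is (for K infinite) the homogeneous ideal
   of X: a polynomial vanishes on X iff all its homogeneous components do. *)
Definition vanishing_ideal X : set {mpoly K[n.+1]} :=
  [set F | forall v, X v -> eval_at F v = 0].

Definition zero_locus I : set 'rV[K]_n.+1 :=
  [set v | v != 0 /\ forall F, I F -> eval_at F v = 0].

Definition zariski_closure X : set 'rV[K]_n.+1 :=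
  zero_locus [set F | vanishing_ideal X F /\ exists d : nat, F \is d.-homog].

Definition zariski_closed X := zariski_closure X = X.

Definition zariski_irreducible X :=
  X !=set0 /\
  forall Y Z, zariski_closed Y -> zariski_closed Z ->
    X `<=` Y `|` Z -> X `<=` Y \/ X `<=` Z.

Definition ideal_generated I : set {mpoly K[n.+1]} :=
  [set F | exists (k : nat) (c g : 'I_k -> {mpoly K[n.+1]}),
     (forall i, I (g i)) /\ F = \sum_(i < k) c i * g i].

Definition translate p F : {mpoly K[n.+1]} :=
  F \mPo [tuple 'X_i + (p 0 i)%:MP | i < n.+1].

(* [mlast] is the smallest monomial for a degree-first monomial order, hence
   [mdeg (mlast F)] is the lowest degree in which F has a nonzero component. *)
Definition initial_form F : {mpoly K[n.+1]} := pihomog mdeg (mdeg (mlast F)) F.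

(* Initial forms at p of the homogeneous equations of X. If p = (1, 0, ..., 0)
   and F = \sum_i x_0^(d - i) F_i(x_1, ..., x_n), then the lowest degree
   component of F(p + x) is F_m(x_1, ..., x_n), with m minimal such that F_m is
   nonzero, i.e., it is the initial form at the origin of the equation
   F(1, x_1, ..., x_n) of X in the affine chart x_0 = 1. The ideal below is then
   the ideal in K[x_0, ..., x_n] of the (closure in P^n of the) tangent cone
   to X at p, as a scheme. *)
Definition tangent_cone_ideal X p : set {mpoly K[n.+1]} :=
  ideal_generated
    [set G | exists (d : nat) F,
       [/\ F \is d.-homog, vanishing_ideal X F &
           G = initial_form (translate p F)]].

Definition tangent_cone X p : set 'rV[K]_n.+1 :=
  zero_locus (tangent_cone_ideal X p).

(* The union of the lines joining p to the points of X. *)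
Definition cone_over X p : set 'rV[K]_n.+1 :=
  [set v | v != 0 /\ exists x, X x /\ exists s t : K, v = s *: p + t *: x].

(* The degree d component of the homogeneous coordinate ring of X has
   dimension h: it has a basis consisting of the classes of h forms. *)
Definition hilbert_value X (d h : nat) :=
  exists b : 'I_h -> {mpoly K[n.+1]},
    (forall i, b i \is d.-homog) /\
    forall F, F \is d.-homog ->
      exists! c : 'rV[K]_h,
        vanishing_ideal X (F - \sum_(i < h) c 0 i *: b i).

(* X has dimension r and degree e: its Hilbert polynomial has degree r and
   leading coefficient e / r!. *)
Definition has_dim_degree X (r e : nat) :=
  exists P : {poly rat},
    [/\ size P = r.+1, lead_coef P = e%:R / (r`!)%:R &
        exists d0 : nat, forall d : nat, (d0 <= d)%N ->
          exists h : nat, hilbert_value X d h /\ h%:R = P.[d%:R]].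

Definition quadric_surface_in (V : {vspace 'rV[K]_n.+1}) X :=
  \dim V = 4%N /\
  exists q : {mpoly K[n.+1]},
    [/\ q \is 2.-homog, exists2 v, v \in V & eval_at q v != 0 &
        X = plinear V `&` [set v | eval_at q v = 0]].

End ProjectiveGeometry.

(* The image of X under the rational map given in homogeneous coordinates by f;
   points x with f x = 0 are in the indeterminacy locus. *)
Definition rational_image (K : fieldType) (m n : nat)
    (f : 'rV[K]_m.+1 -> 'rV[K]_n.+1) (X : set 'rV[K]_m.+1) :
    set 'rV[K]_n.+1 :=
  [set y | y != 0 /\ exists x, X x /\ exists c : K, y = c *: f x].

Section EnriquesFano.
Variable K : fieldType.

Definition sextic_map (t : 'rV[K]_4) : 'rV[K]_14 :=
  let t0 := t 0 (inord 0) in let t1 := t 0 (inord 1) in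
  let t2 := t 0 (inord 2) in let t3 := t 0 (inord 3) in
  \row_(k < 14) nth 0
    [:: t0 * t1 ^+ 3 * t2 * t3;
        t0 ^+ 2 * t1 ^+ 2 * t2 ^+ 2;
        t0 ^+ 2 * t1 ^+ 2 * t2 * t3;
        t0 ^+ 2 * t1 ^+ 2 * t3 ^+ 2;
        t0 ^+ 3 * t1 * t2 * t3;
        t0 * t1 ^+ 2 * t2 ^+ 2 * t3;
        t0 * t1 ^+ 2 * t2 * t3 ^+ 2;
        t0 ^+ 2 * t1 * t2 ^+ 2 * t3;
        t0 ^+ 2 * t1 * t2 * t3 ^+ 2;
        t1 ^+ 2 * t2 ^+ 2 * t3 ^+ 2;
        t0 * t1 * t2 ^+ 3 * t3;
        t0 * t1 * t2 ^+ 2 * t3 ^+ 2;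
        t0 * t1 * t2 * t3 ^+ 3;
        t0 ^+ 2 * t2 ^+ 2 * t3 ^+ 2] k.

Definition W_F13 : set 'rV[K]_14 :=
  zariski_closure (rational_image sextic_map (@pspace K 3)).

(* The projection from the span of E_3; a collects the coefficients of the
   equation of the hyperplane H_12. *)
Definition klm_projection (a w : 'rV[K]_14) : 'rV[K]_10 :=
  \row_(j < 10)
    if j == 0 :> nat then \sum_(k < 5) a 0 (inord k) * w 0 (inord k)
    else w 0 (inord (j + 4)).

Definition W_KLM9 (a : 'rV[K]_14) : set 'rV[K]_10 :=
  zariski_closure (rational_image (klm_projection a) W_F13).

Definition P5 : 'rV[K]_10 := delta_mx 0 0.

End EnriquesFano.

(* Main.v *)
Require Import Defs.
From mathcomp Require Import ring zify.

Import Order.TTheory GRing.Theory Num.Theory.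
Local Open Scope ring_scope.
Local Open Scope classical_set_scope.
Set Implicit Arguments.
Unset Strict Implicit.
Unset Printing Implicit Defensive.

(** Write z_0, ..., z_9 for the coordinates of P^9 and a_0, ..., a_4 for the
    coefficients that enter the projection. Put
      q = a_0 z_1 z_2 + a_1 z_1 z_3 + a_2 z_1 z_4 + a_3 z_2 z_4 + a_4 z_3 z_4,
      l = a_0 z_5 + a_1 z_6 + a_2 z_7 + a_3 z_8 + a_4 z_9.
    On the threefold z_0 z_7 = q, and z_0 z_5 z_6 = z_1^2 l together with three
    analogous cubic relations. Multiplying z_0 z_7 = q by one more coordinate and
    using the monomial relations among z_1, ..., z_9, one gets equations
    z_0 L = H, with L and H forms free of z_0 and deg H = deg L + 1, for
      L = z_7  and fourteen products  L = z_i z_j,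
    and L = z_1 z_4 - z_2 z_3 vanishes itself, so that H = 0 will do.
    In the chart z_0 = 1 the lowest term of such an equation is L, so these
    sixteen forms L belong to the ideal of the tangent cone at P_5. They do not
    depend on the a_i, and their zero locus is the cone with vertex P_5 over the
    coordinate planes 125, 136, 349, 248 and the quadric z_1 z_4 = z_2 z_3 in
    the space 1234 (lemma [cone_ptP]).

    There are no further equations. Each of the five components is swept out by
    tangent directions of explicit arcs t(x) in P^3 whose images tend to P_5: the
    planes 125 and 349 come from arcs tending to a vertex of the tetrahedron, the
    planes 136 and 248 from arcs tending to a generic point of a face, and the
    quadric from arcs tending to a generic point of the edge t_2 = t_3 = 0. Along
    such an arc the image is x^e (A(x) P_5 + x B(x)) with A(0) <> 0, and
    comparing lowest powers of x in F(image) = 0 shows that the initial form of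
    F vanishes at B(0) ([initial_form_arc], [tangent_form_cone]). This is where
    a_0, a_1, a_3, a_4 must be nonzero: they are the coefficients of the leading
    terms of z_0 along the arcs.

    It remains to see that the sixteen forms generate the whole vanishing ideal
    of the cone. Modulo them every polynomial is a combination of normal
    monomials, those divisible by none of z_7, z_1 z_4 and the fourteen products
    ([normal_form]). A combination of normal monomials that vanishes on the cone
    is zero: restrict it to each component, which is parametrized by monomials,
    distinct normal monomials going to distinct monomials in the parameters
    ([normal_form_eq0]). The same normal monomials without z_0 and z_7 form a
    basis of the coordinate ring of the surface M_6 in each degree d, and there
    are (d+1)^2 + 2 d (d+1) = 3 d^2 + 4 d + 1 of them, which gives dimension 2
    and degree 6 ([has_dim_degree_sextic_surface]). *)

(** * Univariate arguments for vanishing and initial forms *)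

Section GenericVanishing.
Variable K : numFieldType.

(** A numeric field contains the pairwise distinct integers 0, 1, 2, ..., more
    of them than p has roots. *)
Lemma exists_nonroot (p : {poly K}) : p != 0 -> exists x, p.[x] != 0.
Proof.
move=> p0; pose s := [seq i%:R | i <- iota 0 (size p)] : seq K.
case: (boolP (all (root p) s)) => [rs|/allPn[x _ rx]]; last by exists x.
have us : uniq s by rewrite map_inj_uniq ?iota_uniq //; apply: mulrIn; apply: oner_neq0.
by have := max_poly_roots p0 rs us; rewrite size_map size_iota ltnn.
Qed.

Lemma poly_eq0_generic (p q : {poly K}) : q != 0 ->
  (forall x, q.[x] != 0 -> p.[x] = 0) -> p = 0.
Proof.
move=> q0 pq; apply/eqP/negPn/negP => p0.
have /exists_nonroot[x] : p * q != 0 by rewrite mulf_neq0.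
by rewrite hornerM mulf_eq0 negb_or => /andP[px /pq pE]; rewrite pE eqxx in px.
Qed.

(** The pullback of the polynomial G to the parametrized curve w. *)
Definition curve_eval n (w : 'I_n -> {poly K}) (G : {mpoly K[n]}) : {poly K} :=
  mmap (@polyC K) w G.

Lemma horner_curve n (w : 'I_n -> {poly K}) (G : {mpoly K[n]}) x :
  (curve_eval w G).[x] = G.@[fun i => (w i).[x]].
Proof.
rewrite /curve_eval /mmap mevalE horner_sum; apply: eq_bigr => m _.
rewrite hornerM hornerC /mmap1 horner_prod; congr (_ * _).
by apply: eq_bigr => i _; rewrite horner_exp.
Qed.

(** Lets points in special position on a curve be treated by proving the
    vanishing only at the points where an auxiliary polynomial q is nonzero. *)
Lemma meval_generic n (w : 'I_n -> {poly K}) (q : {poly K}) (G : {mpoly K[n]}) :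
  q != 0 -> (forall x, q.[x] != 0 -> G.@[fun i => (w i).[x]] = 0) ->
  forall x, G.@[fun i => (w i).[x]] = 0.
Proof.
move=> q0 Gq x; rewrite -horner_curve.
rewrite (poly_eq0_generic (p := curve_eval w G) q0) ?horner0 // => y qy.
by rewrite horner_curve Gq.
Qed.

Lemma dhomog_meval n d (G : {mpoly K[n]}) (c : K) (v : 'I_n -> K) :
  G \is d.-homog -> G.@[fun i => c * v i] = c ^+ d * G.@[v].
Proof.
move=> /dhomogP hG; rewrite !mevalE mulr_sumr [LHS]big_seq [RHS]big_seq.
apply: eq_bigr => m mG; rewrite mulrCA; congr (_ * _).
under eq_bigr do rewrite exprMn.
by rewrite big_split prodrXr -mdegE hG.
Qed.

Lemma initial_formE n d (L H : {mpoly K[n.+1]}) :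
  L \is d.-homog -> H \is d.+1.-homog -> L != 0 -> initial_form (L + H) = L.
Proof.
move=> hL hH L0.
have LH0 : L + H != 0.
  apply: contraNneq L0 => /(congr1 (pihomog mdeg d)).
  rewrite pihomogD pihomog0 pihomog_dE // (pihomog_ne0 _ hH) ?addr0 => [->//|].
  by rewrite neq_ltn ltnSn orbT.
have mL : mlast L \in msupp (L + H).
  rewrite mcoeff_msupp mcoeffD (dhomog_nemf_coeff hH) ?addr0.
    by rewrite -mcoeff_msupp mlast_supp.
  by rewrite (dhomog_mf hL) ?mlast_supp // neq_ltn ltnSn.
suff dE : mdeg (mlast (L + H)) = d.
  rewrite /initial_form dE pihomogD pihomog_dE // (pihomog_ne0 _ hH) ?addr0 //.
  by rewrite neq_ltn ltnSn orbT.
apply/eqP; rewrite eqn_leq; apply/andP; split.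
  by rewrite -(dhomog_mf hL (mlast_supp L0)) lemc_mdeg // mlast_lemc.
have /msuppD_le := mlast_supp LH0; rewrite mem_cat.
by move=> /orP[/(dhomog_mf hL)->|/(dhomog_mf hH)->].
Qed.

(** The arc is x |-> x B(x) / A(x). If T = T_m + T_(m+1) + ... is the
    decomposition into homogeneous parts, clearing the denominators in
    T(x B / A) = 0 and dividing by x^m leaves a polynomial in x whose value at
    0 is A(0)^(N - m) T_m(B(0)). *)
Lemma initial_form_arc n (T : {mpoly K[n.+1]}) (A q : {poly K})
    (B : 'I_n.+1 -> {poly K}) :
  A.[0] != 0 -> q != 0 ->
  (forall e, q.[e] != 0 -> A.[e] != 0 ->
     T.@[fun i => e / A.[e] * (B i).[e]] = 0) ->
  (initial_form T).@[fun i => (B i).[0]] = 0.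
Proof.
move=> A0 q0 TB; case: (eqVneq T 0) => [->|T0].
  by rewrite /initial_form pihomog0 meval0.
rewrite /initial_form; set m := mdeg _; pose N := msize T.
have mN : (m < N)%N by apply: msize_mdeg_lt; apply: mlast_supp.
have Tlow k : (k < m)%N -> pihomog mdeg k T = 0.
  move=> km; rewrite pihomogE big_seq_cond big1 // => mm /andP[mmT /eqP kE].
  by move: km; rewrite -kE ltnNge lemc_mdeg // mlast_lemc.
pose P := \sum_(k < N) 'X^(k - m) * A ^+ (N - k)
            * curve_eval B (pihomog mdeg k T).
have PE x : P.[x] = \sum_(k < N) x ^+ (k - m) * A.[x] ^+ (N - k)
            * (pihomog mdeg k T).@[fun i => (B i).[x]].
  rewrite horner_sum; apply: eq_bigr => k _.
  by rewrite !hornerM hornerXn horner_exp horner_curve.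
have P0 : P = 0.
  apply: (@poly_eq0_generic _ ('X * A * q)).
    rewrite !mulf_neq0 ?polyX_eq0 //.
    by apply: contraNneq A0 => ->; rewrite horner0.
  move=> x; rewrite !hornerM hornerX !mulf_eq0 !negb_or -andbA.
  move=> /and3P[x0 Ax qx].
  apply: (mulfI (expf_neq0 m x0)); rewrite mulr0.
  have /(congr1 (fun y => A.[x] ^+ N * y)) := TB x qx Ax; rewrite mulr0 => <-.
  rewrite [in RHS](pihomog_partitionE (mf := mdeg) (leqnn (msize T))) raddf_sum /=.
  rewrite PE !mulr_sumr; apply: eq_bigr => k _.
  rewrite (dhomog_meval _ _ (pihomogP mdeg k T)).
  have [km|mk] := ltnP k m; first by rewrite Tlow // meval0 !mulr0.
  rewrite !mulrA; congr (_ * _).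
  have -> : A.[x] ^+ N = A.[x] ^+ (N - k) * A.[x] ^+ k.
    by rewrite -exprD subnK // ltnW.
  rewrite -(exprD x) subnKC // expr_div_n [RHS]mulrC -!mulrA (mulrC (_ ^- _)).
  by rewrite mulfK // expf_neq0.
have := PE 0; rewrite P0 horner0 (bigD1 (Ordinal mN)) //= subnn expr0 mul1r.
rewrite big1 ?addr0 => [/esym/eqP|k].
  by rewrite mulf_eq0 expf_eq0 (negPf A0) andbF => /eqP.
rewrite -val_eqE /= neq_ltn => /orP[km|mk]; first by rewrite Tlow // meval0 mulr0.
by rewrite expr0n subn_eq0 leqNgt mk !mul0r.
Qed.

End GenericVanishing.

(** * Polynomials vanishing on monomially parametrized sets *)

Lemma base_digits_inj N n (f g : 'I_n -> nat) :
  (forall i, f i < N)%N -> (forall i, g i < N)%N ->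
  (\sum_i f i * N ^ i = \sum_i g i * N ^ i)%N -> f =1 g.
Proof.
elim: n f g => [|n IH] f g fN gN; first by move=> _ [].
rewrite !big_ord_recl !expn0 !muln1.
have tailE h : (\sum_(i < n) h (lift ord0 i) * N ^ lift ord0 i
    = N * \sum_(i < n) h (lift ord0 i) * N ^ i)%N.
  by rewrite big_distrr; apply: eq_bigr => i _; rewrite lift0 expnS mulnCA.
rewrite !tailE => fg; have N0 : (0 < N)%N by apply: leq_ltn_trans (fN ord0).
have fg0 : f ord0 = g ord0.
  have /(congr1 (modn^~ N)) := fg.
  by rewrite /= !(addnC (_ ord0)) ![(N * _)%N]mulnC !modnMDl !modn_small.
move: fg; rewrite fg0 => /addnI /eqP; rewrite eqn_pmul2l // => /eqP /IH fgS i.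
by case: (unliftP ord0 i) => [j|] -> //; apply: fgS.
Qed.

Section MonomialCurves.
Variable K : numFieldType.

(** Kronecker substitution: along the curve t_i = x^(N^i), with N larger than
    all the exponents of G, distinct monomials of G become distinct powers
    of x. *)
Lemma mpoly_eq0_generic n (G : {mpoly K[n]}) :
  (forall t : 'I_n -> K, (forall j, t j != 0) -> G.@[t] = 0) -> G = 0.
Proof.
move=> G0; pose N := msize G.
pose code (m : 'X_{1..n}) := (\sum_i m i * N ^ i)%N.
pose P := \sum_(m <- msupp G) G@_m *: 'X^(code m) : {poly K}.
have P0 : P = 0.
  apply: (@poly_eq0_generic K P 'X); first by rewrite polyX_eq0.
  move=> x; rewrite hornerX => x0.
  rewrite -[RHS](G0 (fun i => x ^+ (N ^ i)%N)); last by move=> j; apply: expf_neq0.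
  rewrite mevalE horner_sum; apply: eq_bigr => m _.
  rewrite hornerZ hornerXn /code -prodrXr; congr (_ * _).
  by apply: eq_bigr => i _; rewrite mulnC exprM.
apply/mpolyP => m0; rewrite mcoeff0.
case: (boolP (m0 \in msupp G)) => [m0G|/memN_msupp_eq0 //].
have digit m : m \in msupp G -> forall i, (m i < N)%N.
  move=> mG i; apply: leq_ltn_trans (msize_mdeg_lt mG).
  by rewrite mdegE (bigD1 i) ?leq_addr.
have := coef0 K (code m0); rewrite -P0 coef_sum (bigD1_seq m0) ?msupp_uniq //=.
rewrite coefZ coefXn eqxx mulr1 big1_seq ?addr0 // => m /andP[mm0 mG].
rewrite coefZ coefXn; case: eqP => [cE|]; last by rewrite mulr0.
case/eqP: mm0; apply/mnmP.
by apply: (base_digits_inj (digit _ mG) (digit _ m0G)).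
Qed.

(** The points run over the image of a monomial parametrization theta, with
    the coordinates outside S set to zero. Pulling G back along it replaces each
    monomial m supported in S by the monomial sum_i m_i theta_i in the
    parameters; if no other monomial of G has the same image as m0, the
    coefficient of m0 survives as a coefficient of a polynomial that vanishes at
    all points of a torus. *)
Lemma mcoeff_eq0_monomial_param n k (S : pred 'I_n) (theta : 'I_n -> 'X_{1..k})
    (G : {mpoly K[n]}) (m0 : 'X_{1..n}) :
  (forall t : 'I_k -> K, (forall j, t j != 0) ->
     G.@[fun i => if S i then mmap1 t (theta i) else 0] = 0) ->
  (forall i, ~~ S i -> m0 i = 0%N) ->
  (forall m, m \in msupp G -> (forall i, ~~ S i -> m i = 0%N) ->
     (\sum_i theta i *+ m i = \sum_i theta i *+ m0 i)%MM -> m = m0) ->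
  G@_m0 = 0.
Proof.
move=> GS m0S phi_inj.
pose phi (m : 'X_{1..n}) := (\sum_i theta i *+ m i)%MM.
pose onS (m : 'X_{1..n}) := [forall i, S i || (m i == 0%N)].
have onSP m : onS m -> forall i, ~~ S i -> m i = 0%N.
  by move=> /forallP mS i /negPf Si; have := mS i; rewrite Si => /eqP.
pose H := \sum_(m <- msupp G | onS m) G@_m *: 'X_[phi m] : {mpoly K[k]}.
have H0 : H = 0.
  apply: mpoly_eq0_generic => t t0; rewrite -[RHS](GS _ t0) [RHS]mevalE.
  rewrite /H raddf_sum big_mkcond /=; apply: eq_bigr => m _.
  case: ifPn => [mS|]; last first.
    case/forallPn => i; rewrite negb_or => /andP[Si mi].
    by rewrite (bigD1 i) //= (negPf Si) expr0n (negPf mi) mul0r mulr0.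
  rewrite mevalZ mevalX; congr (_ * _).
  transitivity (\prod_j \prod_i t j ^+ (theta i j * m i)%N).
    apply: eq_bigr => j _; rewrite /phi mnm_sumE -prodrXr.
    by apply: eq_bigr => i _; rewrite mulmnE.
  rewrite exchange_big; apply: eq_bigr => i _.
  case: ifPn => [_|/(onSP _ mS) ->]; last by rewrite big1 // => j _; rewrite muln0.
  by rewrite /mmap1 -prodrXl; apply: eq_bigr => j _; rewrite exprM.
case: (boolP (m0 \in msupp G)) => [m0G|/memN_msupp_eq0 //].
have onS0 : onS m0.
  by apply/forallP => i; case: (boolP (S i)) => //= /m0S ->.
have := mcoeff0 K (phi m0).
rewrite -H0 /H raddf_sum big_mkcond (bigD1_seq m0) ?msupp_uniq //= onS0.
rewrite mcoeffZ mcoeffX eqxx mulr1 big1_seq ?addr0 //.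
move=> m /andP[mm0 mG]; case: ifP => // mS; rewrite mcoeffZ mcoeffX.
case: eqP => [pE|]; last by rewrite mulr0.
by case/eqP: mm0; apply: phi_inj => //; apply: onSP.
Qed.

End MonomialCurves.

(** * Points and equations of the threefold *)

Section HomogeneousComposition.
Variable K : numFieldType.

Lemma dhomog_prod_ord n k (lq : 'I_n -> {mpoly K[k]}) (e : 'I_n -> nat) :
  (forall i, lq i \is 1.-homog) ->
  \prod_i lq i ^+ e i \is (\sum_i e i)%N.-homog.
Proof.
move=> hlq; elim/big_rec2: _ => [|i d p _ hp]; first exact: dhomog1.
by apply: dhomogM => //; have := dhomogMn (e i) (hlq i); rewrite mul1n.
Qed.

Lemma dhomog_comp_mpoly n k d (F : {mpoly K[n]}) (lq : n.-tuple {mpoly K[k]}) :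
  F \is d.-homog -> (forall i, tnth lq i \is 1.-homog) ->
  F \mPo lq \is d.-homog.
Proof.
move=> /dhomogP hF hlq; rewrite comp_mpolyEX big_seq rpred_sum // => m mF.
rewrite rpredZ // comp_mpolyX -(hF _ mF) /= mdegE.
exact: (dhomog_prod_ord (lq := tnth lq)).
Qed.

End HomogeneousComposition.

Section KLMThreefold.
Variables (K : numFieldType) (a : 'rV[K]_14).

Definition klm_point (t : 'rV[K]_4) : 'rV[K]_10 :=
  klm_projection a (sextic_map t).

(** The projection from the span of E_3 as a tuple of linear forms, through
    which forms on P^9 are pulled back to forms on P^13. *)
Definition klm_forms : 10.-tuple {mpoly K[14]} :=
  [tuple if j == 0 :> nat then \sum_(k < 5) a 0 (inord k) *: 'X_(inord k)
         else 'X_(inord (j + 4)) | j < 10].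

Lemma meval_klm_forms (w : 'rV[K]_14) j :
  (tnth klm_forms j).@[fun i => w 0 i] = klm_projection a w 0 j.
Proof.
rewrite tnth_mktuple mxE; case: ifP => _; last by rewrite mevalXU.
by rewrite raddf_sum; apply: eq_bigr => k _; rewrite /= mevalZ mevalXU.
Qed.

Lemma dhomog_klm_forms j : tnth klm_forms j \is 1.-homog.
Proof.
rewrite tnth_mktuple; case: ifP => _; last by rewrite dhomogX /= mdeg1.
by apply: rpred_sum => k _; rewrite rpredZ // dhomogX /= mdeg1.
Qed.

(** Closures add no condition for a form: it vanishes on the closure of a set as
    soon as it vanishes on the set. As the threefold is a closure of a
    projection of a closure, this is applied twice, to F and to its pullback
    to P^13. *)
Lemma vanishing_ideal_W_KLM9 d (F : {mpoly K[10]}) : F \is d.-homog ->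
  (forall t, eval_at F (klm_point t) = 0) -> vanishing_ideal (W_KLM9 a) F.
Proof.
move=> hF Ft v [_]; apply; split; last by exists d.
move=> y [_ [x [[_ xW] [c ->]]]]; rewrite /eval_at.
rewrite (meval_eq (v2 := fun i => c * klm_projection a x 0 i)); last first.
  by move=> i; rewrite mxE.
rewrite (dhomog_meval _ _ hF).
have comp_evalE (w : 'rV[K]_14) : (F \mPo klm_forms).@[fun i => w 0 i]
    = F.@[fun i => klm_projection a w 0 i].
  by rewrite comp_mpoly_meval; apply: meval_eq => i; apply: meval_klm_forms.
rewrite -comp_evalE -/(eval_at _ x) xW ?mulr0 //; split; last first.
  by exists d; apply: dhomog_comp_mpoly => //; apply: dhomog_klm_forms.
move=> w [_ [t [_ [b ->]]]]; rewrite /eval_at.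
rewrite (meval_eq (v2 := fun i => b * sextic_map t 0 i)); last first.
  by move=> i; rewrite mxE.
rewrite (dhomog_meval _ _ (dhomog_comp_mpoly hF dhomog_klm_forms)).
by rewrite comp_evalE -/(eval_at F (klm_point t)) Ft mulr0.
Qed.

Lemma zariski_closure_sub n (X : set 'rV[K]_n.+1) v :
  v != 0 -> X v -> zariski_closure X v.
Proof. by move=> v0 Xv; split=> // F [FX _]; apply: FX. Qed.

Lemma klm_point_in_W_KLM9 t : klm_point t != 0 -> W_KLM9 a (klm_point t).
Proof.
move=> kt0; apply: zariski_closure_sub => //; split=> //.
have st0 : sextic_map t != 0.
  apply: contraNneq kt0 => st0; apply/eqP/rowP => j.
  rewrite /klm_point st0 !mxE; case: ifP => // _.
  by rewrite big1 // => k _; rewrite mxE mulr0.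
exists (sextic_map t); split; last by exists 1; rewrite scale1r.
apply: zariski_closure_sub => //; split=> //.
exists t; split; last by exists 1; rewrite scale1r.
apply: contraNneq st0 => ->; apply/eqP/rowP => j; rewrite !mxE.
by case: j => j; do 14?case: j => [|j] //=; rewrite ?expr0n ?mul0r ?mulr0.
Qed.

Definition row4 (x0 x1 x2 x3 : K) : 'rV[K]_4 :=
  \row_(j < 4) [:: x0; x1; x2; x3]`_j.

(** z_0 divided by t_0 t_1. The other coordinates do not involve the a_i. *)
Definition klm_leading (t0 t1 t2 t3 : K) : K :=
  a 0 (inord 0) * t1 ^+ 2 * t2 * t3 + a 0 (inord 1) * t0 * t1 * t2 ^+ 2
  + a 0 (inord 2) * t0 * t1 * t2 * t3 + a 0 (inord 3) * t0 * t1 * t3 ^+ 2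
  + a 0 (inord 4) * t0 ^+ 2 * t2 * t3.

Definition klm_coords (t0 t1 t2 t3 : K) : seq K :=
  [:: t0 * t1 * klm_leading t0 t1 t2 t3;
      t0 * t1 ^+ 2 * t2 ^+ 2 * t3; t0 * t1 ^+ 2 * t2 * t3 ^+ 2;
      t0 ^+ 2 * t1 * t2 ^+ 2 * t3; t0 ^+ 2 * t1 * t2 * t3 ^+ 2;
      t1 ^+ 2 * t2 ^+ 2 * t3 ^+ 2; t0 * t1 * t2 ^+ 3 * t3;
      t0 * t1 * t2 ^+ 2 * t3 ^+ 2; t0 * t1 * t2 * t3 ^+ 3;
      t0 ^+ 2 * t2 ^+ 2 * t3 ^+ 2].

Lemma klm_pointE (t : 'rV[K]_4) j : klm_point t 0 j =
  (klm_coords (t 0 (inord 0)) (t 0 (inord 1)) (t 0 (inord 2)) (t 0 (inord 3)))`_j.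
Proof.
rewrite mxE; case: j => j; do 10?[case: j => [|j] /=] => // ltj.
  rewrite !big_ord_recl big_ord0 /= !mxE !inordK //= /klm_leading; ring.
all: by rewrite mxE inordK.
Qed.

End KLMThreefold.

(** * Equations of the tangent cone *)

Section ConeEquations.
Variable K : numFieldType.

Local Notation X i := ('X_(inord i) : {mpoly K[10]}).

Lemma translateX (p : 'rV[K]_10) i : translate p 'X_i = 'X_i + (p 0 i)%:MP.
Proof. by rewrite /translate comp_mpolyXU -tnth_nth tnth_mktuple. Qed.

Lemma translateD (p : 'rV[K]_10) : {morph translate p : F G / F + G}.
Proof. by move=> F G; apply: rmorphD. Qed.
Lemma translateB (p : 'rV[K]_10) : {morph translate p : F G / F - G}.
Proof. by move=> F G; apply: rmorphB. Qed.
Lemma translateM (p : 'rV[K]_10) : {morph translate p : F G / F * G}.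
Proof. by move=> F G; apply: rmorphM. Qed.
Lemma translateZ (p : 'rV[K]_10) c : {morph translate p : F / c *: F}.
Proof. by move=> F; apply: comp_mpolyZ. Qed.
Lemma translate0 (p : 'rV[K]_10) : translate p 0 = 0.
Proof. exact: rmorph0. Qed.

Lemma translate_P5X i : (0 < i < 10)%N -> translate (P5 K) (X i) = X i.
Proof.
move=> i0; rewrite translateX mxE eqxx /= -val_eqE /= inordK; last by lia.
by case: i i0 => // i _; rewrite addr0.
Qed.

Lemma translate_P5X0 : translate (P5 K) (X 0) = X 0 + 1.
Proof. by rewrite translateX mxE eqxx /= -val_eqE /= inordK. Qed.

End ConeEquations.

Section Ideals.
Variables (K : numFieldType) (n : nat) (I : set {mpoly K[n.+1]}).

Lemma ideal_generated_sub F : I F -> ideal_generated I F.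
Proof.
by move=> IF; exists 1%N, (fun=> 1), (fun=> F); split=> //; rewrite big_ord1 mul1r.
Qed.

Lemma ideal_generated0 : ideal_generated I 0.
Proof.
by exists 0%N, (fun=> 0), (fun=> 0); split=> [[]//|]; rewrite big_ord0.
Qed.

Lemma ideal_generatedM F G : ideal_generated I G -> ideal_generated I (F * G).
Proof.
move=> [k [c [g [Ig ->]]]]; exists k, (fun i => F * c i), g; split=> //.
by rewrite mulr_sumr; apply: eq_bigr => i _; rewrite mulrA.
Qed.

Lemma ideal_generatedD F G :
  ideal_generated I F -> ideal_generated I G -> ideal_generated I (F + G).
Proof.
move=> [k [c [g [Ig ->]]]] [l [d [h [Ih ->]]]].
pose glue T (f : 'I_k -> T) (f' : 'I_l -> T) i :=
  match split i with inl j => f j | inr j => f' j end.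
exists (k + l)%N, (glue _ c d), (glue _ g h); split=> [i|].
  by rewrite /glue; case: split.
rewrite big_split_ord; congr (_ + _); apply: eq_bigr => i _; rewrite /glue.
  by case: splitP => j /= ij; [rewrite (ord_inj ij)|have := ltn_ord i; lia].
by case: splitP => j /= ij; [have := ltn_ord j; lia|rewrite (ord_inj (addnI ij))].
Qed.

End Ideals.

Section TangentConeEquations.
Variables (K : numFieldType) (a : 'rV[K]_14).

Local Notation X i := ('X_(inord i) : {mpoly K[10]}).
Local Notation al i := (a 0 (inord i)).
Local Notation inTC := (tangent_cone_ideal (W_KLM9 a) (P5 K)).

Lemma dhomog_var i : X i \is 1.-homog.
Proof. by rewrite dhomogX /= mdeg1. Qed.

(** In the chart z_0 = 1 the equation z_0 L = H becomes L = H, whose lowest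
    term is L. In terms of the translated equation, z_0 L - H becomes
    (1 + z_0) L - H, with the same lowest term. *)
Lemma linear_lift_in_tangent_cone d (L H : {mpoly K[10]}) :
  L \is d.-homog -> H \is d.+1.-homog ->
  translate (P5 K) L = L -> translate (P5 K) H = H ->
  (forall t, eval_at (X 0 * L - H) (klm_point a t) = 0) -> inTC L.
Proof.
move=> hL hH tL tH Wt; case: (eqVneq L 0) => [->|L0].
  exact: ideal_generated0.
have hXL : X 0 * L \is d.+1.-homog.
  by have := dhomogM (dhomog_var 0) hL; rewrite add1n.
have hF : X 0 * L - H \is d.+1.-homog by rewrite rpredB.
apply: ideal_generated_sub; exists d.+1, (X 0 * L - H); split=> //.
  exact: vanishing_ideal_W_KLM9 hF Wt.
rewrite translateB translateM tL tH translate_P5X0.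
by rewrite mulrDl mul1r [_ + L]addrC -addrA (initial_formE hL).
Qed.

Definition klm_quadric : {mpoly K[10]} :=
  al 0 *: (X 1 * X 2) + al 1 *: (X 1 * X 3) + al 2 *: (X 1 * X 4)
  + al 3 *: (X 2 * X 4) + al 4 *: (X 3 * X 4).

Definition klm_linear : {mpoly K[10]} :=
  al 0 *: X 5 + al 1 *: X 6 + al 2 *: X 7 + al 3 *: X 8 + al 4 *: X 9.

(** Products that vanish on the tangent cone. Each of z_5, z_6, z_8, z_9 belongs
    to a single plane of the cone; its product with the three others, and with
    the two variables among z_1, ..., z_4 that vanish on this plane, is zero. *)
Definition zero_pairs : seq (nat * nat) :=
  [:: (3, 5); (4, 5); (2, 6); (4, 6); (1, 8); (3, 8); (1, 9); (2, 9);
      (5, 9); (6, 8); (5, 6); (5, 8); (6, 9); (8, 9)]%N.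

Lemma dhomog_var2 i j : X i * X j \is 2.-homog.
Proof. exact: (dhomogM (dhomog_var i) (dhomog_var j)). Qed.

Lemma dhomog_klm_quadric : klm_quadric \is 2.-homog.
Proof. by rewrite !rpredD // rpredZ // dhomog_var2. Qed.

Lemma dhomog_klm_linear : klm_linear \is 1.-homog.
Proof. by rewrite !rpredD // rpredZ // dhomog_var. Qed.

Lemma translate_klm_quadric : translate (P5 K) klm_quadric = klm_quadric.
Proof. by rewrite !(translateD, translateZ, translateM) !translate_P5X. Qed.

Lemma translate_klm_linear : translate (P5 K) klm_linear = klm_linear.
Proof. by rewrite !(translateD, translateZ) !translate_P5X. Qed.

Ltac klm_ring :=
  rewrite /eval_at /klm_quadric /klm_linear
    ?(mevalB, mevalD, mevalM, mevalZ, mevalXU, meval0) !klm_pointE !inordK //=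
    /klm_leading; ring.

Lemma tangent_cone_X7 : inTC (X 7).
Proof.
apply: (linear_lift_in_tangent_cone (dhomog_var 7) dhomog_klm_quadric).
- by rewrite translate_P5X.
- exact: translate_klm_quadric.
by move=> t; klm_ring.
Qed.

Lemma tangent_cone_quadric : inTC (X 1 * X 4 - X 2 * X 3).
Proof.
apply: (@linear_lift_in_tangent_cone 2 _ 0).
- by rewrite rpredB // dhomog_var2.
- exact: rpred0.
- by rewrite translateB !translateM !translate_P5X.
- exact: translate0.
by move=> t; klm_ring.
Qed.

(** Multiplying z_0 z_7 = q by z_k and using a relation z_i z_j = z_k z_7 gives
    z_0 z_i z_j = z_k q. The last four products are not of this form; for them
    z_0 z_i z_j = z_k^2 l. *)
Lemma tangent_cone_zero_pair i j : (i, j) \in zero_pairs -> inTC (X i * X j).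
Proof.
have viaq k : (0 < i < 10)%N && (0 < j < 10)%N && (0 < k < 10)%N ->
    (forall t, eval_at (X 0 * (X i * X j) - X k * klm_quadric) (klm_point a t) = 0) ->
    inTC (X i * X j).
  move=> /andP[/andP[ib jb] kb].
  apply: (linear_lift_in_tangent_cone (dhomog_var2 i j)).
  - exact: (dhomogM (dhomog_var k) dhomog_klm_quadric).
  - by rewrite translateM !translate_P5X.
  - by rewrite translateM translate_P5X // translate_klm_quadric.
have vial k : (0 < i < 10)%N && (0 < j < 10)%N && (0 < k < 10)%N ->
    (forall t, eval_at (X 0 * (X i * X j) - X k * X k * klm_linear)
       (klm_point a t) = 0) ->
    inTC (X i * X j).
  move=> /andP[/andP[ib jb] kb].
  apply: (linear_lift_in_tangent_cone (dhomog_var2 i j)).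
  - exact: (dhomogM (dhomog_var2 k k) dhomog_klm_linear).
  - by rewrite translateM !translate_P5X.
  - by rewrite !translateM translate_P5X // translate_klm_linear.
rewrite /zero_pairs.
rewrite in_cons => /predU1P[[iE jE]|].
  by apply: (viaq 1%N); rewrite iE jE // => t; klm_ring.
rewrite in_cons => /predU1P[[iE jE]|].
  by apply: (viaq 2%N); rewrite iE jE // => t; klm_ring.
rewrite in_cons => /predU1P[[iE jE]|].
  by apply: (viaq 1%N); rewrite iE jE // => t; klm_ring.
rewrite in_cons => /predU1P[[iE jE]|].
  by apply: (viaq 3%N); rewrite iE jE // => t; klm_ring.
rewrite in_cons => /predU1P[[iE jE]|].
  by apply: (viaq 2%N); rewrite iE jE // => t; klm_ring.
rewrite in_cons => /predU1P[[iE jE]|].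
  by apply: (viaq 4%N); rewrite iE jE // => t; klm_ring.
rewrite in_cons => /predU1P[[iE jE]|].
  by apply: (viaq 3%N); rewrite iE jE // => t; klm_ring.
rewrite in_cons => /predU1P[[iE jE]|].
  by apply: (viaq 4%N); rewrite iE jE // => t; klm_ring.
rewrite in_cons => /predU1P[[iE jE]|].
  by apply: (viaq 7%N); rewrite iE jE // => t; klm_ring.
rewrite in_cons => /predU1P[[iE jE]|].
  by apply: (viaq 7%N); rewrite iE jE // => t; klm_ring.
rewrite in_cons => /predU1P[[iE jE]|].
  by apply: (vial 1%N); rewrite iE jE // => t; klm_ring.
rewrite in_cons => /predU1P[[iE jE]|].
  by apply: (vial 2%N); rewrite iE jE // => t; klm_ring.
rewrite in_cons => /predU1P[[iE jE]|].
  by apply: (vial 3%N); rewrite iE jE // => t; klm_ring.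
rewrite in_cons => /predU1P[[iE jE]|].
  by apply: (vial 4%N); rewrite iE jE // => t; klm_ring.
by [].
Qed.

End TangentConeEquations.

(** * Arcs on the threefold through the singular point *)

(** Coordinatewise proof of a statement on the ten coordinates of P^9. *)
Lemma ord10_ind (P : 'I_10 -> Prop) :
  P (inord 0) -> P (inord 1) -> P (inord 2) -> P (inord 3) -> P (inord 4) ->
  P (inord 5) -> P (inord 6) -> P (inord 7) -> P (inord 8) -> P (inord 9) ->
  forall j, P j.
Proof.
move=> P0 P1 P2 P3 P4 P5 P6 P7 P8 P9 j; rewrite -[j]inord_val; case: j => j /=.
by do 10?[case: j => [|j] //].
Qed.

Section Arcs.
Variables (K : numFieldType) (a : 'rV[K]_14).
Local Notation al i := (a 0 (inord i)).

(** The generators of the ideal of the tangent cone at P_5. *)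
Definition tangent_form (G : {mpoly K[10]}) := exists (d : nat) F,
  [/\ F \is d.-homog, vanishing_ideal (W_KLM9 a) F &
      G = initial_form (translate (P5 K) F)].

Definition coords (s : seq K) : 'I_10 -> K := fun i => s`_i.

(** A curve t(x) whose image is x^e (A(x) P_5 + x B(x)) is an arc of the
    threefold through P_5 with tangent direction B(0). Since the cone has vertex
    P_5, the coordinate s along P_5 of the direction is arbitrary: s x is
    subtracted from A to get it. *)
Lemma tangent_form_arc (t : K -> 'rV[K]_4) (e : nat) (A : {poly K})
    (B : seq {poly K}) (s : K) (v : seq K) (G : {mpoly K[10]}) :
  tangent_form G -> A.[0] != 0 ->
  (forall x (j : 'I_10), klm_point a (t x) 0 j =
     x ^+ e * (if j == 0 then A.[x] else x * (B`_j.-1).[x])) ->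
  s :: [seq p.[0] | p <- B] = v -> G.@[coords v] = 0.
Proof.
move=> [d [F [hF WF ->]]] A0 tAB <-.
pose A' : {poly K} := A - s *: 'X.
pose B' (i : 'I_10) : {poly K} := nth 0 (s%:P :: B) i.
have A'0 : A'.[0] != 0 by rewrite /A' !hornerE subr0.
have A_neq0 : A != 0 by apply: contraNneq A0 => ->; rewrite horner0.
have q0 : 'X * A != 0 by rewrite mulf_neq0 ?polyX_eq0.
rewrite (meval_eq (v2 := fun i => (B' i).[0])); last first.
  move=> i; rewrite /B' /coords; case: i => [[|i] lti] /=; first by rewrite hornerC.
  have [iB|iB] := ltnP i (size B); first by rewrite (nth_map 0).
  by rewrite !nth_default ?horner0 ?size_map.
apply: (initial_form_arc A'0 q0) => x; rewrite hornerM hornerX mulf_eq0 negb_or.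
move=> /andP[x0 Ax] A'x; rewrite /translate comp_mpoly_meval.
(* The point P_5 + (x / A') B' is the image of t x rescaled by this factor. *)
pose c := (A'.[x])^-1 * x ^- e.
have cE y : c * (x ^+ e * y) = (A'.[x])^-1 * y.
  by rewrite /c -mulrA mulKf ?expf_neq0.
rewrite (meval_eq (v2 := fun i => c * klm_point a (t x) 0 i)); last first.
  move=> i; rewrite tnth_mktuple mevalD mevalXU mevalC tAB mxE eqxx /=.
  rewrite cE -!val_eqE /=.
  case: i => [[|i] lti] /=; last by rewrite /B' /= addr0; field.
  have AE : A.[x] = A'.[x] + x * s by rewrite /A' !hornerE; ring.
  by rewrite /B' /= hornerC AE; field.
rewrite (dhomog_meval _ _ hF) -/(eval_at F (klm_point a (t x))).
rewrite WF ?mulr0 //; apply: klm_point_in_W_KLM9.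
apply/eqP => /rowP/(_ 0)/eqP; rewrite tAB mxE eqxx.
by apply/negP; rewrite mulf_neq0 ?expf_neq0.
Qed.

Lemma dhomog_tangent_form G : tangent_form G -> exists d, G \is d.-homog.
Proof. by move=> [d [F [_ _ ->]]]; eexists; apply: pihomogP. Qed.

Lemma tangent_form_scale (G : {mpoly K[10]}) (c : K) (v : seq K) : c != 0 ->
  tangent_form G -> G.@[coords [seq c * x | x <- v]] = 0 -> G.@[coords v] = 0.
Proof.
move=> c0 /dhomog_tangent_form[d hG].
rewrite (meval_eq (v2 := fun i => c * coords v i)); last first.
  move=> i; rewrite /coords; have [iv|iv] := ltnP i (size v).
    by rewrite (nth_map 0).
  by rewrite !nth_default ?mulr0 ?size_map.
rewrite (dhomog_meval _ _ hG) => /eqP.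
by rewrite mulf_eq0 expf_eq0 (negPf c0) andbF => /eqP.
Qed.

Ltac arc_coords := let x := fresh "x" in move=> x; apply: ord10_ind;
  rewrite klm_pointE /klm_coords !mxE -!val_eqE /= !inordK //= /klm_leading
    ?(hornerD, hornerZ, hornerC, hornerXn, hornerX); ring.

Ltac arc_limit :=
  rewrite /= ?(hornerD, hornerZ, hornerC, hornerXn, hornerX);
  do 10?[congr cons; try ring].

(** Arcs that tend to the vertex [0 : 1 : 0 : 0], where z_0 is of order x^3
    through the term w_0 and only z_1, z_2, z_5 are of order x^4. *)
Lemma tangent_form_plane1_arc G s p0 p2 p3 : tangent_form G ->
  al 0 != 0 -> p0 != 0 -> p2 != 0 -> p3 != 0 ->
  G.@[coords [:: s; p0 * p2 ^+ 2 * p3; p0 * p2 * p3 ^+ 2; 0; 0;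
               p2 ^+ 2 * p3 ^+ 2; 0; 0; 0; 0]] = 0.
Proof.
move=> TG al0 n0 n2 n3.
apply: (tangent_form_arc (t := fun x => row4 (x * p0) 1 (x * p2) (x * p3))
  (e := 3) (s := s)
  (A := (al 0 * p0 * p2 * p3)%:P
    + (p0 ^+ 2 * (al 1 * p2 ^+ 2 + al 2 * p2 * p3 + al 3 * p3 ^+ 2)) *: 'X
    + (al 4 * p0 ^+ 3 * p2 * p3) *: 'X ^+ 2)
  (B := [:: (p0 * p2 ^+ 2 * p3)%:P; (p0 * p2 * p3 ^+ 2)%:P;
    (p0 ^+ 2 * p2 ^+ 2 * p3) *: 'X; (p0 ^+ 2 * p2 * p3 ^+ 2) *: 'X;
    (p2 ^+ 2 * p3 ^+ 2)%:P; (p0 * p2 ^+ 3 * p3) *: 'X;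
    (p0 * p2 ^+ 2 * p3 ^+ 2) *: 'X; (p0 * p2 * p3 ^+ 3) *: 'X;
    (p0 ^+ 2 * p2 ^+ 2 * p3 ^+ 2) *: 'X ^+ 2]) TG).
- rewrite !(hornerD, hornerZ, hornerC, hornerXn, hornerX).
  by rewrite expr0n !mulr0 !addr0 !mulf_neq0.
- arc_coords.
- arc_limit.
Qed.

(** Exchanges the roles of t_0 and t_1: arcs that tend to [1 : 0 : 0 : 0], with
    z_0 dominated by its term in w_4. *)
Lemma tangent_form_plane1'_arc G s p1 p2 p3 : tangent_form G ->
  al 4 != 0 -> p1 != 0 -> p2 != 0 -> p3 != 0 ->
  G.@[coords [:: s; 0; 0; p1 * p2 ^+ 2 * p3; p1 * p2 * p3 ^+ 2; 0; 0; 0; 0;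
               p2 ^+ 2 * p3 ^+ 2]] = 0.
Proof.
move=> TG al4 n1 n2 n3.
apply: (tangent_form_arc (t := fun x => row4 1 (x * p1) (x * p2) (x * p3))
  (e := 3) (s := s)
  (A := (al 4 * p1 * p2 * p3)%:P
    + (p1 ^+ 2 * (al 1 * p2 ^+ 2 + al 2 * p2 * p3 + al 3 * p3 ^+ 2)) *: 'X
    + (al 0 * p1 ^+ 3 * p2 * p3) *: 'X ^+ 2)
  (B := [:: (p1 ^+ 2 * p2 ^+ 2 * p3) *: 'X; (p1 ^+ 2 * p2 * p3 ^+ 2) *: 'X;
    (p1 * p2 ^+ 2 * p3)%:P; (p1 * p2 * p3 ^+ 2)%:P;
    (p1 ^+ 2 * p2 ^+ 2 * p3 ^+ 2) *: 'X ^+ 2; (p1 * p2 ^+ 3 * p3) *: 'X;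
    (p1 * p2 ^+ 2 * p3 ^+ 2) *: 'X; (p1 * p2 * p3 ^+ 3) *: 'X;
    (p2 ^+ 2 * p3 ^+ 2)%:P]) TG).
- rewrite !(hornerD, hornerZ, hornerC, hornerXn, hornerX).
  by rewrite expr0n !mulr0 !addr0 !mulf_neq0.
- arc_coords.
- arc_limit.
Qed.

(** Arcs that tend to a point of the face t_3 = 0, where z_0 has a nonzero
    limit because of its term in w_1 and only z_1, z_3, z_6 are of first order. *)
Lemma tangent_form_plane2_arc G s p0 p1 p2 : tangent_form G ->
  al 1 != 0 -> p0 != 0 -> p1 != 0 -> p2 != 0 ->
  G.@[coords [:: s; p0 * p1 ^+ 2 * p2 ^+ 2; 0; p0 ^+ 2 * p1 * p2 ^+ 2; 0; 0;
               p0 * p1 * p2 ^+ 3; 0; 0; 0]] = 0.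
Proof.
move=> TG al1 n0 n1 n2.
apply: (tangent_form_arc (t := fun x => row4 p0 p1 p2 x)
  (e := 0) (s := s)
  (A := (al 1 * p0 * p0 * p1 * p1 * p2 * p2)%:P
    + (p0 * p1 * p2 * (al 0 * p1 ^+ 2 + al 2 * p0 * p1 + al 4 * p0 ^+ 2)) *: 'X
    + (al 3 * p0 ^+ 2 * p1 ^+ 2) *: 'X ^+ 2)
  (B := [:: (p0 * p1 ^+ 2 * p2 ^+ 2)%:P; (p0 * p1 ^+ 2 * p2) *: 'X;
    (p0 ^+ 2 * p1 * p2 ^+ 2)%:P; (p0 ^+ 2 * p1 * p2) *: 'X;
    (p1 ^+ 2 * p2 ^+ 2) *: 'X; (p0 * p1 * p2 ^+ 3)%:P;
    (p0 * p1 * p2 ^+ 2) *: 'X; (p0 * p1 * p2) *: 'X ^+ 2;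
    (p0 ^+ 2 * p2 ^+ 2) *: 'X]) TG).
- rewrite !(hornerD, hornerZ, hornerC, hornerXn, hornerX).
  by rewrite expr0n !mulr0 !addr0 !mulf_neq0.
- arc_coords.
- arc_limit.
Qed.

(** Exchanges the roles of t_2 and t_3, with z_0 dominated by its term in w_3. *)
Lemma tangent_form_plane2'_arc G s p0 p1 p3 : tangent_form G ->
  al 3 != 0 -> p0 != 0 -> p1 != 0 -> p3 != 0 ->
  G.@[coords [:: s; 0; p0 * p1 ^+ 2 * p3 ^+ 2; 0; p0 ^+ 2 * p1 * p3 ^+ 2; 0; 0; 0;
               p0 * p1 * p3 ^+ 3; 0]] = 0.
Proof.
move=> TG al3 n0 n1 n3.
apply: (tangent_form_arc (t := fun x => row4 p0 p1 x p3)
  (e := 0) (s := s)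
  (A := (al 3 * p0 * p0 * p1 * p1 * p3 * p3)%:P
    + (p0 * p1 * p3 * (al 0 * p1 ^+ 2 + al 2 * p0 * p1 + al 4 * p0 ^+ 2)) *: 'X
    + (al 1 * p0 ^+ 2 * p1 ^+ 2) *: 'X ^+ 2)
  (B := [:: (p0 * p1 ^+ 2 * p3) *: 'X; (p0 * p1 ^+ 2 * p3 ^+ 2)%:P;
    (p0 ^+ 2 * p1 * p3) *: 'X; (p0 ^+ 2 * p1 * p3 ^+ 2)%:P;
    (p1 ^+ 2 * p3 ^+ 2) *: 'X; (p0 * p1 * p3) *: 'X ^+ 2;
    (p0 * p1 * p3 ^+ 2) *: 'X; (p0 * p1 * p3 ^+ 3)%:P;
    (p0 ^+ 2 * p3 ^+ 2) *: 'X]) TG).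
- rewrite !(hornerD, hornerZ, hornerC, hornerXn, hornerX).
  by rewrite expr0n !mulr0 !addr0 !mulf_neq0.
- arc_coords.
- arc_limit.
Qed.

(** Arcs that tend to a point of the edge t_2 = t_3 = 0: z_0 has order 2 in x,
    z_1, ..., z_4 order 3 and the other coordinates order 4. The directions form
    the Segre image of P^1 x P^1. *)
Lemma tangent_form_quadric_arc G s p0 p1 p2 p3 : tangent_form G ->
  p0 * p1 * p2 * p3 * klm_leading a p0 p1 p2 p3 != 0 ->
  G.@[coords [:: s; p1 * p2; p1 * p3; p0 * p2; p0 * p3; 0; 0; 0; 0; 0]] = 0.
Proof.
move=> TG; rewrite !mulf_eq0 !negb_or -!andbA => /and5P[n0 n1 n2 n3 nl].
have k0 : p0 * p1 * p2 * p3 != 0 by rewrite !mulf_neq0.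
apply: (tangent_form_scale k0 TG).
apply: (tangent_form_arc (t := fun x => row4 p0 p1 (x * p2) (x * p3))
  (e := 2) (s := p0 * p1 * p2 * p3 * s)
  (A := (p0 * p1 * klm_leading a p0 p1 p2 p3)%:P)
  (B := [:: (p0 * p1 ^+ 2 * p2 ^+ 2 * p3)%:P; (p0 * p1 ^+ 2 * p2 * p3 ^+ 2)%:P;
    (p0 ^+ 2 * p1 * p2 ^+ 2 * p3)%:P; (p0 ^+ 2 * p1 * p2 * p3 ^+ 2)%:P;
    (p1 ^+ 2 * p2 ^+ 2 * p3 ^+ 2) *: 'X; (p0 * p1 * p2 ^+ 3 * p3) *: 'X;
    (p0 * p1 * p2 ^+ 2 * p3 ^+ 2) *: 'X; (p0 * p1 * p2 * p3 ^+ 3) *: 'X;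
    (p0 ^+ 2 * p2 ^+ 2 * p3 ^+ 2) *: 'X]) TG).
- by rewrite hornerC !mulf_neq0.
- arc_coords.
- arc_limit.
Qed.

(** A direction in special position is the value at 0 of a polynomial family W
    of directions, almost all of which are generic. *)
Lemma tangent_form_generic G (W : seq {poly K}) (q : {poly K}) (v : seq K) :
  q != 0 -> (forall x, q.[x] != 0 -> G.@[coords [seq p.[x] | p <- W]] = 0) ->
  [seq p.[0] | p <- W] = v -> G.@[coords v] = 0.
Proof.
move=> q0 GW <-.
have WE x : (fun i => (coords [seq p.[x] | p <- W]) i) =1 (fun i : 'I_10 => (W`_i).[x]).
  move=> i; rewrite /coords; have [iW|iW] := ltnP i (size W).
    by rewrite (nth_map 0).
  by rewrite !nth_default ?horner0 ?size_map.
rewrite (meval_eq _ (WE 0)); apply: (meval_generic q0) => x qx.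
by rewrite -(meval_eq _ (WE x)) GW.
Qed.

Hypotheses (a0 : al 0 != 0) (a1 : al 1 != 0) (a3 : al 3 != 0) (a4 : al 4 != 0).

(** The arc with (p0, p2, p3) = (x1 x2, x1 x5, x2 x5) has direction proportional
    to (x1, x2, x5): the quadratic Cremona transformation is an involution. *)
Lemma tangent_form_plane1 G s x1 x2 x5 : tangent_form G ->
  G.@[coords [:: s; x1; x2; 0; 0; x5; 0; 0; 0; 0]] = 0.
Proof.
move=> TG.
apply: (@tangent_form_generic _
  [:: s%:P; 'X + x1%:P; 'X + x2%:P; 0; 0; 'X + x5%:P; 0; 0; 0; 0]
  (('X + x1%:P) * ('X + x2%:P) * ('X + x5%:P))).
- by rewrite !mulf_neq0 // -size_poly_gt0 size_XaddC.
- move=> x; rewrite /= ?(hornerD, hornerM, hornerC, hornerX) ?horner0.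
  move: (x + x1) (x + x2) (x + x5) => {}x1 {}x2 {}x5.
  rewrite !mulf_eq0 !negb_or -andbA => /and3P[n1 n2 n3].
  have k0 : (x1 * x5 * (x2 * x5) * (x1 * x2 * x5)) != 0 by rewrite !mulf_neq0.
  apply: (tangent_form_scale k0 TG).
  rewrite -[RHS](tangent_form_plane1_arc
    ((x1 * x5 * (x2 * x5) * (x1 * x2 * x5)) * s) TG a0
    (mulf_neq0 n1 n2) (mulf_neq0 n1 n3) (mulf_neq0 n2 n3)).
  by congr (G.@[coords _]); do 10?[congr cons; try ring].
- by rewrite /= ?(hornerD, hornerC, hornerX) !add0r ?horner0.
Qed.

Lemma tangent_form_plane1' G s x3 x4 x9 : tangent_form G ->
  G.@[coords [:: s; 0; 0; x3; x4; 0; 0; 0; 0; x9]] = 0.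
Proof.
move=> TG.
apply: (@tangent_form_generic _
  [:: s%:P; 0; 0; 'X + x3%:P; 'X + x4%:P; 0; 0; 0; 0; 'X + x9%:P]
  (('X + x3%:P) * ('X + x4%:P) * ('X + x9%:P))).
- by rewrite !mulf_neq0 // -size_poly_gt0 size_XaddC.
- move=> x; rewrite /= ?(hornerD, hornerM, hornerC, hornerX) ?horner0.
  move: (x + x3) (x + x4) (x + x9) => {}x3 {}x4 {}x9.
  rewrite !mulf_eq0 !negb_or -andbA => /and3P[n1 n2 n3].
  have k0 : (x3 * x9 * (x4 * x9) * (x3 * x4 * x9)) != 0 by rewrite !mulf_neq0.
  apply: (tangent_form_scale k0 TG).
  rewrite -[RHS](tangent_form_plane1'_arc
    ((x3 * x9 * (x4 * x9) * (x3 * x4 * x9)) * s) TG a4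
    (mulf_neq0 n1 n2) (mulf_neq0 n1 n3) (mulf_neq0 n2 n3)).
  by congr (G.@[coords _]); do 10?[congr cons; try ring].
- by rewrite /= ?(hornerD, hornerC, hornerX) !add0r ?horner0.
Qed.

Lemma tangent_form_plane2 G s x1 x3 x6 : tangent_form G ->
  G.@[coords [:: s; x1; 0; x3; 0; 0; x6; 0; 0; 0]] = 0.
Proof.
move=> TG.
apply: (@tangent_form_generic _
  [:: s%:P; 'X + x1%:P; 0; 'X + x3%:P; 0; 0; 'X + x6%:P; 0; 0; 0]
  (('X + x1%:P) * ('X + x3%:P) * ('X + x6%:P))).
- by rewrite !mulf_neq0 // -size_poly_gt0 size_XaddC.
- move=> x; rewrite /= ?(hornerD, hornerM, hornerC, hornerX) ?horner0.
  move: (x + x1) (x + x3) (x + x6) => {}x1 {}x3 {}x6.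
  rewrite !mulf_eq0 !negb_or -andbA => /and3P[n1 n2 n3].
  have k0 : (x1 * x3 * x6 ^+ 2) != 0 by rewrite !mulf_neq0.
  apply: (tangent_form_scale k0 TG).
  rewrite -[RHS](tangent_form_plane2_arc ((x1 * x3 * x6 ^+ 2) * s) TG a1
    n2 n1 n3).
  by congr (G.@[coords _]); do 10?[congr cons; try ring].
- by rewrite /= ?(hornerD, hornerC, hornerX) !add0r ?horner0.
Qed.

Lemma tangent_form_plane2' G s x2 x4 x8 : tangent_form G ->
  G.@[coords [:: s; 0; x2; 0; x4; 0; 0; 0; x8; 0]] = 0.
Proof.
move=> TG.
apply: (@tangent_form_generic _
  [:: s%:P; 0; 'X + x2%:P; 0; 'X + x4%:P; 0; 0; 0; 'X + x8%:P; 0]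
  (('X + x2%:P) * ('X + x4%:P) * ('X + x8%:P))).
- by rewrite !mulf_neq0 // -size_poly_gt0 size_XaddC.
- move=> x; rewrite /= ?(hornerD, hornerM, hornerC, hornerX) ?horner0.
  move: (x + x2) (x + x4) (x + x8) => {}x2 {}x4 {}x8.
  rewrite !mulf_eq0 !negb_or -andbA => /and3P[n1 n2 n3].
  have k0 : (x2 * x4 * x8 ^+ 2) != 0 by rewrite !mulf_neq0.
  apply: (tangent_form_scale k0 TG).
  rewrite -[RHS](tangent_form_plane2'_arc ((x2 * x4 * x8 ^+ 2) * s) TG a3
    n2 n1 n3).
  by congr (G.@[coords _]); do 10?[congr cons; try ring].
- by rewrite /= ?(hornerD, hornerC, hornerX) !add0r ?horner0.
Qed.

(** The arcs reach the points where p0 p1 p2 p3 and the leading coefficient of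
    z_0 are nonzero. Any other point is joined by a line in the parameters to
    (1, y, 1, 1), for some y at which none of them vanishes. *)
Lemma tangent_form_segre G s p0 p1 p2 p3 : tangent_form G ->
  G.@[coords [:: s; p1 * p2; p1 * p3; p0 * p2; p0 * p3; 0; 0; 0; 0; 0]] = 0.
Proof.
move=> TG; pose lead_at y := klm_leading a 1 y 1 1.
(* At (1, y, 1, 1) the leading coefficient is a quadratic polynomial in y with
   constant term a_4. *)
have [y y0 ly0] : exists2 y, y != 0 & lead_at y != 0.
  pose r : {poly K} := al 0 *: 'X ^+ 2 + (al 1 + al 2 + al 3) *: 'X + (al 4)%:P.
  have r0 : r != 0.
    apply: contraNneq a4 => /(congr1 (horner^~ 0)).
    rewrite /r /= !(hornerD, hornerZ, hornerC, hornerXn, hornerX).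
    by rewrite expr0n !mulr0 !add0r => ->; rewrite ?horner0.
  have /exists_nonroot[y] : 'X * r != 0 by rewrite mulf_neq0 ?polyX_eq0.
  rewrite hornerM hornerX mulf_eq0 negb_or => /andP[y0 ry]; exists y => //.
  suff -> : lead_at y = r.[y] by [].
  rewrite /r !(hornerD, hornerZ, hornerC, hornerXn, hornerX) /lead_at /klm_leading.
  by ring.
pose line (u v : K) : {poly K} := u%:P + (v - u) *: 'X.
have lineE u v x : (line u v).[x] = u + (v - u) * x.
  by rewrite /line hornerD hornerC hornerZ hornerX.
pose q0 := line p0 1; pose q1 := line p1 y; pose q2 := line p2 1; pose q3 := line p3 1.
pose lead : {poly K} := al 0 *: (q1 ^+ 2 * q2 * q3) + al 1 *: (q0 * q1 * q2 ^+ 2)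
  + al 2 *: (q0 * q1 * q2 * q3) + al 3 *: (q0 * q1 * q3 ^+ 2)
  + al 4 *: (q0 ^+ 2 * q2 * q3).
have leadE x : lead.[x] = klm_leading a q0.[x] q1.[x] q2.[x] q3.[x].
  by rewrite /lead !(hornerD, hornerZ, hornerM, horner_exp) /klm_leading !mulrA.
apply: (@tangent_form_generic _
  [:: s%:P; q1 * q2; q1 * q3; q0 * q2; q0 * q3; 0; 0; 0; 0; 0]
  (q0 * q1 * q2 * q3 * lead)).
- suff: (q0 * q1 * q2 * q3 * lead).[1] != 0.
    by apply: contraNneq => ->; rewrite horner0.
  rewrite !hornerM leadE !lineE !mulr1 !subrKC.
  by rewrite !mulf_neq0 ?oner_neq0.
- move=> x; rewrite /= !hornerM hornerC horner0 leadE.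
  exact: tangent_form_quadric_arc.
- by rewrite /= !hornerM hornerC horner0 !lineE !mulr0 !addr0.
Qed.

End Arcs.

(** * The components of the cone *)

Local Notation z v i := (v 0 (inord i)).
Local Notation e m i := (m (inord i)).
Local Notation U i := (U_(inord i : 'I_10))%MM.

Section Cone.
Variable K : numFieldType.
Implicit Types (v : 'rV[K]_10) (s : seq nat).

Definition supported s v := forall i : 'I_10, (i : nat) \notin s -> v 0 i = 0.

(** The coordinates that may be nonzero on the cones over the four planes;
    index 0 is the vertex. *)
Definition plane_supports : seq (seq nat) :=
  [:: [:: 0; 1; 2; 5]; [:: 0; 3; 4; 9]; [:: 0; 1; 3; 6]; [:: 0; 2; 4; 8]]%N.

(** The zero locus of the sixteen equations of the tangent cone. *)
Definition cone_pt v :=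
  [/\ z v 7 = 0, z v 1 * z v 4 = z v 2 * z v 3 &
      forall p, p \in zero_pairs -> z v p.1 * z v p.2 = 0].

Lemma supportedE s v i : supported s v -> (i < 10)%N -> i \notin s -> z v i = 0.
Proof. by move=> sv i10 si; apply: sv; rewrite inordK. Qed.

Lemma zero_pairs_lt10 p : p \in zero_pairs -> (p.1 < 10)%N && (p.2 < 10)%N.
Proof. by move: p; apply/allP. Qed.

Lemma cone_pt_plane s v :
  s \in plane_supports -> supported s v -> cone_pt v.
Proof.
move=> sP sv; have v0 i := supportedE (i := i) sv.
have zz p : p \in zero_pairs -> z v p.1 * z v p.2 = 0.
  move=> pP; have [p1 p2] := andP (zero_pairs_lt10 pP).
  have : (p.1 \notin s) || (p.2 \notin s).
    by move: pP {p1 p2}; move: p; apply/allP; move: s sP {sv v0}; apply/allP.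
  by case/orP => [/(v0 _ p1)|/(v0 _ p2)] ->; rewrite ?mul0r ?mulr0.
have prod0 i j : (i < 10)%N -> (j < 10)%N -> (i \notin s) || (j \notin s) ->
    z v i * z v j = 0.
  by move=> i10 j10 /orP[/(v0 _ i10)|/(v0 _ j10)] ->; rewrite ?mul0r ?mulr0.
have : [&& 7 \notin s, (1 \notin s) || (4 \notin s) & (2 \notin s) || (3 \notin s)]%N.
  by move: s sP {sv v0 zz prod0}; apply/allP.
by case/and3P => s7 s14 s23; split=> //; [exact: v0|rewrite !prod0].
Qed.

Lemma cone_pt_quadric v : supported [:: 0; 1; 2; 3; 4]%N v ->
  z v 1 * z v 4 = z v 2 * z v 3 -> cone_pt v.
Proof.
move=> sv qv; have v0 i := supportedE (i := i) sv.
split=> // [|p pP]; first by rewrite v0.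
have [p1 p2] := andP (zero_pairs_lt10 pP).
rewrite (v0 p.2) ?mulr0 //.
by move: pP {p1 p2}; move: p; apply/allP.
Qed.

(** If one of z_5, z_6, z_8, z_9 is nonzero, the products kill all the
    coordinates outside the plane that contains it; otherwise only the quadric
    equation is left. *)
Lemma cone_ptP v : cone_pt v ->
  (exists2 s, s \in plane_supports & supported s v) \/
  (supported [:: 0; 1; 2; 3; 4]%N v /\ z v 1 * z v 4 = z v 2 * z v 3).
Proof.
move=> [v7 vq vd].
have off (s : seq nat) : all (fun i => (i \in s) || (z v i == 0)) (iota 0 10) ->
    supported s v.
  move=> /allP vs i si; have := vs i; rewrite mem_iota ltn_ord (negPf si) inord_val.
  by move=> /(_ isT)/eqP.
have cut i j : (i, j) \in zero_pairs -> z v i != 0 -> z v j == 0.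
  by move=> /vd /= /eqP; rewrite mulf_eq0 => /orP[->|].
have cut' i j : (i, j) \in zero_pairs -> z v j != 0 -> z v i == 0.
  by move=> /vd /= /eqP; rewrite mulf_eq0 => /orP[|->].
have [x5|x5] := eqVneq (z v 5) 0; last first.
  left; exists [:: 0; 1; 2; 5]%N => //; apply: off.
  by rewrite /= v7 eqxx ?(cut' 3 5)%N ?(cut' 4 5)%N ?(cut 5 6)%N ?(cut 5 8)%N
    ?(cut 5 9)%N.
have [x9|x9] := eqVneq (z v 9) 0; last first.
  left; exists [:: 0; 3; 4; 9]%N => //; apply: off.
  by rewrite /= v7 x5 eqxx ?(cut' 1 9)%N ?(cut' 2 9)%N ?(cut' 6 9)%N ?(cut' 8 9)%N.
have [x6|x6] := eqVneq (z v 6) 0; last first.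
  left; exists [:: 0; 1; 3; 6]%N => //; apply: off.
  by rewrite /= v7 x5 x9 eqxx ?(cut' 2 6)%N ?(cut' 4 6)%N ?(cut 6 8)%N.
have [x8|x8] := eqVneq (z v 8) 0; last first.
  left; exists [:: 0; 2; 4; 8]%N => //; apply: off.
  by rewrite /= v7 x5 x9 x6 eqxx ?(cut' 1 8)%N ?(cut' 3 8)%N.
by right; split=> //; apply: off; rewrite /= x5 x6 v7 x8 x9 eqxx.
Qed.

End Cone.

(** * Initial forms vanish on the cone; reduction to normal monomials *)

Section TangentForms.
Variables (K : numFieldType) (a : 'rV[K]_14).
Local Notation al i := (a 0 (inord i)).
Hypotheses (a0 : al 0 != 0) (a1 : al 1 != 0) (a3 : al 3 != 0) (a4 : al 4 != 0).

Lemma supported_coords s (v : 'rV[K]_10) : supported s v ->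
  (fun i => v 0 i) =1 coords [seq if i \in s then z v i else 0 | i <- iota 0 10].
Proof.
move=> sv i; rewrite /coords (nth_map 0%N) ?size_iota // nth_iota // inord_val.
by case: ifPn => // /sv.
Qed.

Lemma segre_param (x1 x2 x3 x4 : K) : x1 * x4 = x2 * x3 ->
  exists p0 p1 p2 p3, [/\ x1 = p1 * p2, x2 = p1 * p3, x3 = p0 * p2 & x4 = p0 * p3].
Proof.
have [-> /esym/eqP|x1n0 xE] := eqVneq x1 0; last first.
  exists (x3 / x1), 1, x1, x2; split; rewrite ?mul1r ?divfK //.
  by apply: (mulfI x1n0); rewrite xE; field.
rewrite mul0r mulf_eq0 => /orP[] /eqP ->.
  by exists 1, 0, x3, x4; rewrite !mul0r !mul1r.
by exists x4, x2, 0, 1; rewrite !mulr0 !mulr1.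
Qed.

(** Every point of the cone lies on one of the five components, and each
    component consists of limits of tangent directions of arcs. *)
Lemma tangent_form_cone G (v : 'rV[K]_10) :
  tangent_form a G -> cone_pt v -> eval_at G v = 0.
Proof.
move=> TG /cone_ptP[[s sP sv]|[sv vq]];
  rewrite /eval_at (meval_eq _ (supported_coords sv)).
  move: sP; rewrite !inE => /or4P[] /eqP -> /=.
  - exact: (tangent_form_plane1 a0 _ _ _ _ TG).
  - exact: (tangent_form_plane1' a4 _ _ _ _ TG).
  - exact: (tangent_form_plane2 a1 _ _ _ _ TG).
  - exact: (tangent_form_plane2' a3 _ _ _ _ TG).
have [p0 [p1 [p2 [p3 [e1 e2 e3 e4]]]]] := segre_param vq.
by rewrite /= e1 e2 e3 e4; apply: (tangent_form_segre a4).
Qed.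

Lemma tangent_cone_ideal_cone G (v : 'rV[K]_10) :
  tangent_cone_ideal (W_KLM9 a) (P5 K) G -> cone_pt v -> eval_at G v = 0.
Proof.
move=> [k [c [g [Ig ->]]]] cv; rewrite /eval_at raddf_sum big1 //= => i _.
by rewrite mevalM -/(eval_at (g i) v) tangent_form_cone ?mulr0 //; apply: Ig.
Qed.

End TangentForms.

Section NormalForms.
Variable K : numFieldType.
Implicit Types m : 'X_{1..10}.
Local Notation X i := ('X_(inord i) : {mpoly K[10]}).

(** The monomials outside the ideal generated by z_7, z_1 z_4 and the fourteen
    products, which is the initial ideal of the tangent cone for an order in
    which z_1 z_4 is larger than z_2 z_3. *)
Definition normal m := [&& e m 7 == 0, e m 1 * e m 4 == 0 &
  all (fun p => e m p.1 * e m p.2 == 0) zero_pairs]%N.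

Lemma mnm_factor m i : (0 < e m i)%N -> m = (m - U i + U i)%MM.
Proof.
move=> mi; rewrite submK //; apply/mnm_lepP => j; rewrite mnm1E.
by case: eqP => [<-|].
Qed.

Lemma mnm_factor2 m i j : (0 < e m i)%N -> (0 < e m j)%N ->
  (inord i : 'I_10) != inord j ->
  m = (m - U i - U j + (U i + U j))%MM.
Proof.
move=> mi mj ij; rewrite [(U i + _)%MM]addmC addmA -[in RHS]mnm_factor.
  exact: mnm_factor.
by rewrite mnmBE mnm1E (negPf ij) subn0.
Qed.

Variables (J : set {mpoly K[10]}).
Hypotheses (J0 : J 0) (JD : forall F G, J F -> J G -> J (F + G))
  (JM : forall F G, J G -> J (F * G)).
Hypotheses (J7 : J (X 7))
  (Jd : forall p, p \in zero_pairs -> J (X p.1 * X p.2))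
  (Jq : J (X 1 * X 4 - X 2 * X 3)).

(** The only rewriting that does not kill the monomial replaces z_1 z_4 by
    z_2 z_3, which lowers the exponent of z_1. *)
Lemma normal_form_monomial m : J 'X_[m] \/
  exists m', [/\ normal m', mdeg m' = mdeg m & J ('X_[m] - 'X_[m'])].
Proof.
have [n] := ubnP (e m 1); elim: n m => // n IH m; rewrite ltnS => m1n.
have [m7|m7] := posnP (e m 7); last first.
  by left; rewrite (mnm_factor m7) mpolyXD; apply: JM.
have [md|/allPn[p pP]] := boolP (all (fun p => e m p.1 * e m p.2 == 0)%N zero_pairs);
    last first.
  rewrite -lt0n muln_gt0 => /andP[mp1 mp2]; left.
  have p12 : (inord p.1 : 'I_10) != inord p.2.
    have [p1 p2] := andP (zero_pairs_lt10 pP).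
    rewrite -val_eqE /= !inordK //; move: pP {p1 p2 mp1 mp2}; move: p.
    by apply/allP.
  rewrite (mnm_factor2 mp1 mp2 p12) mpolyXD [Y in _ * Y]mpolyXD.
  exact/JM/Jd.
have [m14|] := posnP (e m 1 * e m 4).
  by right; exists m; rewrite /normal m7 m14 md subrr.
rewrite muln_gt0 => /andP[m1 m4].
have n14 : (inord 1 : 'I_10) != inord 4 by rewrite -val_eqE /= !inordK.
pose r := (m - U 1 - U 4)%MM.
have mE : m = (r + (U 1 + U 4))%MM := mnm_factor2 m1 m4 n14.
pose m2 := (r + (U 2 + U 3))%MM.
have Jm : J ('X_[m] - 'X_[m2]).
  by rewrite mE !mpolyXD -mulrBr; apply: JM.
have m2deg : mdeg m2 = mdeg m by rewrite mE !mdegD !mdeg1.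
have m21 : (e m2 1 < n)%N.
  apply: (leq_trans _ m1n).
  rewrite [in Y in (_ < Y)%N]mE /m2 !mnmDE !mnm1E -!val_eqE /= !inordK //=.
  by lia.
have [Jm2|[m' [nm' dm' Jm']]] := IH m2 m21.

  by left; rewrite -(subrK 'X_[m2] 'X_[m]); apply: JD.
right; exists m'; split=> //; first by rewrite dm'.
by rewrite -(subrKA 'X_[m2]); apply: JD.
Qed.

(** Stated for an arbitrary ideal J containing the sixteen equations, so that it
    applies both to the ideal of the tangent cone and to that of the surface. *)
Lemma normal_form F : exists R, J (F - R) /\
  forall m, m \in msupp R -> normal m /\ exists2 m0, m0 \in msupp F & mdeg m = mdeg m0.
Proof.
suff H (s : seq 'X_{1..10}) : exists R, J (\sum_(m <- s) F@_m *: 'X_[m] - R) /\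
    forall m, m \in msupp R -> normal m /\ exists2 m0, m0 \in s & mdeg m = mdeg m0.
  by rewrite {1}[F]mpolyE; apply: H.
elim: s => [|m s [R [JR sR]]].
  by exists 0; rewrite big_nil subr0; split; rewrite ?msupp0.
have JZ c G : J G -> J (c *: G) by rewrite -mul_mpolyC; apply: JM.
rewrite big_cons; case: (normal_form_monomial m) => [Jm|[m' [nm' dm' Jm]]].
  exists R; split; first by rewrite -addrA; apply: JD => //; apply: JZ.
  by move=> q /sR[nq [m0 m0s dq]]; split=> //; exists m0; rewrite // inE m0s orbT.
exists (F@_m *: 'X_[m'] + R); split.
  by rewrite opprD addrACA -scalerBr; apply: JD => //; apply: JZ.
move=> q /msuppD_le; rewrite mem_cat => /orP[/msuppZ_le|/sR[nq [m0 m0s dq]]].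
  by rewrite msuppX inE => /eqP ->; split=> //; exists m; rewrite ?mem_head.
by split=> //; exists m0; rewrite // inE m0s orbT.
Qed.

End NormalForms.

(** * Independence of the normal monomials *)

Lemma sum_ord10 (f : 'I_10 -> nat) : (\sum_i f i = e f 0 + e f 1 + e f 2 + e f 3 + e f 4
  + e f 5 + e f 6 + e f 7 + e f 8 + e f 9)%N.
Proof.
rewrite !big_ord_recl big_ord0 addn0 !addnA.
by do 9?congr addn; congr (f _); apply: val_inj; rewrite /= inordK.
Qed.

Lemma exponents_off (m : 'X_{1..10}) (s : seq nat) :
  all (fun i => (i \in s) || (e m i == 0%N)) (iota 0 10) ->
  forall i : 'I_10, (i : nat) \notin s -> m i = 0%N.
Proof.
move=> /allP ms i si; have := ms i; rewrite mem_iota ltn_ord (negPf si) inord_val.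
by move=> /(_ isT)/eqP.
Qed.

(** The maximal faces of the simplicial complex of the initial ideal, except
    that 0123 and 0234 are kept together as the support of the cone over the
    quadric. *)
Lemma normal_cases m : normal m ->
  exists2 s, s \in [:: 0; 1; 2; 3; 4]%N :: plane_supports &
    forall i : 'I_10, (i : nat) \notin s -> m i = 0%N.
Proof.
move=> nm; have := nm; rewrite /normal /zero_pairs /= !muln_eq0.
case/and3P => m7 m14; do 14!case/andP => ?; move=> _.
have [m5|m5] := eqVneq (e m 5) 0%N; last first.
  by exists [:: 0; 1; 2; 5]%N; [rewrite !inE eqxx ?orbT|apply: exponents_off => /=; lia].
have [m9|m9] := eqVneq (e m 9) 0%N; last first.
  by exists [:: 0; 3; 4; 9]%N; [rewrite !inE eqxx ?orbT|apply: exponents_off => /=; lia].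
have [m6|m6] := eqVneq (e m 6) 0%N; last first.
  by exists [:: 0; 1; 3; 6]%N; [rewrite !inE eqxx ?orbT|apply: exponents_off => /=; lia].
have [m8|m8] := eqVneq (e m 8) 0%N; last first.
  by exists [:: 0; 2; 4; 8]%N; [rewrite !inE eqxx ?orbT|apply: exponents_off => /=; lia].
by exists [:: 0; 1; 2; 3; 4]%N; [rewrite !inE eqxx ?orbT|apply: exponents_off => /=; lia].
Qed.

Section Uniqueness.
Variable K : numFieldType.

(** The coefficient at a normal monomial supported in one of the planes is
    detected by restricting to that plane. On the quadric use the
    parametrization (z_1, z_2, z_3, z_4) = (z_2 y, z_2, z_4 y, z_4): as z_1 and z_4
    do not both occur, the exponents can be recovered from those of
    z_2, z_4 and y. *)
Lemma normal_form_eq0 (R : {mpoly K[10]}) :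
  (forall m, m \in msupp R -> normal m) ->
  (forall v : 'rV[K]_10, cone_pt v -> (exists2 i : 'I_10, i != 0 & v 0 i != 0) ->
     eval_at R v = 0) ->
  R = 0.
Proof.
move=> nR R0; apply/mpolyP => m0; rewrite mcoeff0.
case: (boolP (m0 \in msupp R)) => [m0R|/memN_msupp_eq0 //].
have [s] := normal_cases (nR _ m0R); rewrite in_cons => /predU1P[->|sP] m0s.
  pose th (i : 'I_10) := (nth 0 [:: U 0; U 2 + U 9; U 2; U 4 + U 9; U 4] i)%MM.
  apply: (mcoeff_eq0_monomial_param (S := fun i => (i : nat) \in [:: 0; 1; 2; 3; 4]%N)
    (theta := th)) => [t t0|//|m mR ms].
    pose v : 'rV[K]_10 :=
      \row_i if (i : nat) \in [:: 0; 1; 2; 3; 4]%N then mmap1 t (th i) else 0.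
    rewrite (meval_eq (v2 := fun i => v 0 i)) => [|i]; last by rewrite mxE.
    apply: R0.
      apply: cone_pt_quadric => [i si|]; first by rewrite mxE (negPf si).
      rewrite !mxE !inordK //= /th !inordK //= !commr_mmap1_M ?mmap1U;
        try (by move=> i x; apply: mulrC).
      ring.
    exists (inord 2); first by rewrite -val_eqE /= inordK.
    by rewrite mxE inordK //= /th inordK //= mmap1U.
  have thE (m' : 'X_{1..10}) j : ((\sum_i th i *+ m' i)%MM j =
      th (inord 0) j * e m' 0 + th (inord 1) j * e m' 1 + th (inord 2) j * e m' 2
      + th (inord 3) j * e m' 3 + th (inord 4) j * e m' 4)%N.
    rewrite mnm_sumE sum_ord10 !mulmnE; by rewrite /th !inordK //= !mnm0E; lia.
  move=> phiE.
  have {}phiE j := congr1 (fun m : 'X_{1..10} => m j) phiE.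
  have := (phiE (inord 0), phiE (inord 2), phiE (inord 4), phiE (inord 9)).
  rewrite /= !thE /th !inordK //= !mnmDE !mnm1E -!val_eqE /= !inordK //=.
  have /and3P[_ + _] := nR _ mR; rewrite muln_eq0 => m14.
  have /and3P[_ + _] := nR _ m0R; rewrite muln_eq0 => m014.
  move=> [[[phi0 phi2] phi4] phi9]; apply/mnmP; apply: ord10_ind;
    try by rewrite ms ?m0s ?inordK.
  1-5: by clear - m14 m014 phi0 phi2 phi4 phi9; case/orP: m14; case/orP: m014; lia.
apply: (mcoeff_eq0_monomial_param (S := fun i => (i : nat) \in s)
    (theta := fun i => U_(i)%MM)) => [t t0|//|m mR ms]; last first.
  by rewrite -!multinomUE_id.
pose v : 'rV[K]_10 := \row_i if (i : nat) \in s then t i else 0.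
rewrite (meval_eq (v2 := fun i => v 0 i)) => [|i]; last by rewrite mxE mmap1U.
apply: R0; first by apply: cone_pt_plane sP _ => i si; rewrite mxE (negPf si).
have [i si i0] : exists2 i, i \in s & (0 < i < 10)%N.
  by exists (nth 0%N s 1); move: s sP {m0s v}; apply/allP.
have iK : (inord i : 'I_10) = i :> nat by apply: inordK; case/andP: i0.
by exists (inord i); [rewrite -val_eqE /= iK; lia|rewrite mxE iK si].
Qed.

End Uniqueness.

(** * Counting the normal monomials *)

Local Notation basis_index d := ('I_d.+1 * 'I_d.+1 + bool * ('I_d * 'I_d.+1))%type.

(** Normal monomials of degree d in z_1, ..., z_6, z_8, z_9. Those in
    z_1, ..., z_4 restrict to the forms of bidegree (d, d) on P^1 x P^1 and are
    indexed by a pair (p, q). Those involving z_5, resp. z_9, are counted by the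
    two triangles j <= i and i < j that make up a d by d + 1 rectangle; a second
    rectangle accounts for z_6 and z_8. *)
Definition basis_exponents d (x : basis_index d) : seq nat :=
  match x with
  | inl (p, q) => [:: 0; p + q - d; p - (p + q - d); q - (p + q - d);
                      d - (p + q); 0; 0; 0; 0; 0]
  | inr (true, (i, j)) =>
      if (j <= i)%N then [:: 0; j : nat; i - j; 0; 0; d - i; 0; 0; 0; 0]
      else [:: 0; 0; 0; i : nat; j.-1 - i; 0; 0; 0; 0; d - j.-1]
  | inr (false, (i, j)) =>
      if (j <= i)%N then [:: 0; j : nat; 0; i - j; 0; 0; d - i; 0; 0; 0]
      else [:: 0; 0; i : nat; 0; j.-1 - i; 0; 0; 0; d - j.-1; 0]
  end%N.

Definition basis_monomial d (x : basis_index d) : 'X_{1..10} :=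
  [multinom nth 0%N (basis_exponents x) i | i < 10].

Lemma basis_monomialE d (x : basis_index d) i : (i < 10)%N ->
  e (basis_monomial x) i = nth 0%N (basis_exponents x) i.
Proof. by move=> i10; rewrite mnmE inordK. Qed.

Lemma size_basis_exponents d (x : basis_index d) : size (basis_exponents x) = 10.
Proof. by case: x => [[p q]|[[] [i j]]] //=; case: ifP. Qed.

Lemma basis_monomial_normal d (x : basis_index d) : normal (basis_monomial x).
Proof.
rewrite /normal /zero_pairs /= !basis_monomialE //.
case: x => [[p q]|[[] [i j]]] /=; rewrite ?muln0 ?eqxx ?andbT //.
- rewrite muln_eq0 !subn_eq0; exact: leq_total.
- by case: ifP; rewrite /= ?muln0 ?mul0n ?eqxx.
- by case: ifP; rewrite /= ?muln0 ?mul0n ?eqxx.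
Qed.

Lemma basis_monomial_mdeg d (x : basis_index d) : mdeg (basis_monomial x) = d.
Proof.
rewrite mdegE sum_ord10 !basis_monomialE //; case: x => [[p q]|[b [i j]]].
  by have := ltn_ord p; have := ltn_ord q; rewrite /=; lia.
have id := ltn_ord i; have jd := ltn_ord j.
by case: b => /=; case: (leqP j i) => /=; lia.
Qed.

Lemma basis_monomial0 d (x : basis_index d) : e (basis_monomial x) 0 = 0%N.
Proof. by rewrite basis_monomialE //; case: x => [[p q]|[[] [i j]]] //=; case: ifP. Qed.

Lemma basis_monomial_inj d : injective (@basis_monomial d).
Proof.
move=> x y xy; have {xy} : basis_exponents x = basis_exponents y.
  apply: (@eq_from_nth _ 0%N); rewrite ?size_basis_exponents // => i i10.
  by rewrite -!basis_monomialE // xy.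
have ordE n (u v : 'I_n) : (u = v :> nat) -> u = v by move=> uv; apply: val_inj.
case: x => [[p q]|[b [i j]]]; case: y => [[p' q']|[b' [i' j']]].
- have := ltn_ord p; have := ltn_ord q; have := ltn_ord p'; have := ltn_ord q'.
  move=> ? ? ? ? [] *; congr (inl (_, _)); apply: ordE; lia.
- have id := ltn_ord i'; have jd := ltn_ord j'.
  by case: b' => /=; case: leqP => ? [] *; lia.
- have id := ltn_ord i; have jd := ltn_ord j.
  by case: b => /=; case: leqP => ? [] *; lia.
have id := ltn_ord i; have jd := ltn_ord j.
have id' := ltn_ord i'; have jd' := ltn_ord j'.
by case: b; case: b' => /=; case: leqP => ?; case: leqP => ? [] *;
  first [lia | congr (inr (_, (_, _))); apply: ordE; lia].
Qed.

(** By the classification of the normal monomials; the index is read off from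
    the exponents. *)
Lemma basis_monomial_surj (m : 'X_{1..10}) : normal m -> e m 0 = 0%N ->
  exists x : basis_index (mdeg m), basis_monomial x = m.
Proof.
move=> nm m0; set d := mdeg m; have dE : d = _ := etrans (mdegE m) (sum_ord10 m).
have eqm (x : basis_index d) : basis_exponents x = [seq e m i | i <- iota 0 10] ->
    basis_monomial x = m.
  move=> hx; apply/mnmP => i; rewrite mnmE hx (nth_map 0%N) ?size_iota //.
  by rewrite nth_iota // inord_val.
have /and3P[/eqP m7 + _] := nm; rewrite muln_eq0 => m14.
have quad : e m 5 = 0%N -> e m 6 = 0%N -> e m 8 = 0%N -> e m 9 = 0%N ->
    exists x : basis_index d, basis_monomial x = m.
  move=> m5 m6 m8 m9.
  have pd : (e m 1 + e m 2 < d.+1)%N by lia.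
  have qd : (e m 1 + e m 3 < d.+1)%N by lia.
  exists (inl (Ordinal pd, Ordinal qd)); apply: eqm.
  by rewrite /= m0 m5 m6 m7 m8 m9; congr [:: _; _; _; _; _; _; _; _; _; _]; lia.
have [s sP ms] := normal_cases nm.
have {}ms i : (i < 10)%N -> i \notin s -> e m i = 0%N.
  by move=> i10 si; apply: ms; rewrite inordK.
move: sP; rewrite in_cons => /predU1P[sE|]; first by apply: quad; rewrite ms // sE.
rewrite !inE => /or4P[] /eqP sE.
- have m3 : e m 3 = 0%N by rewrite ms // sE.
  have m4 : e m 4 = 0%N by rewrite ms // sE.
  have m6 : e m 6 = 0%N by rewrite ms // sE.
  have m8 : e m 8 = 0%N by rewrite ms // sE.
  have m9 : e m 9 = 0%N by rewrite ms // sE.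
  have [m5|m5] := posnP (e m 5); first exact: quad.
  have id : (e m 1 + e m 2 < d)%N by lia.
  have jd : (e m 1 < d.+1)%N by lia.
  exists (inr (true, (Ordinal id, Ordinal jd))); apply: eqm.
  rewrite /= leq_addr m0 m3 m4 m6 m7 m8 m9.
  by congr [:: _; _; _; _; _; _; _; _; _; _]; lia.
- have m1 : e m 1 = 0%N by rewrite ms // sE.
  have m2 : e m 2 = 0%N by rewrite ms // sE.
  have m5 : e m 5 = 0%N by rewrite ms // sE.
  have m6 : e m 6 = 0%N by rewrite ms // sE.
  have m8 : e m 8 = 0%N by rewrite ms // sE.
  have [m9|m9] := posnP (e m 9); first exact: quad.
  have id : (e m 3 < d)%N by lia.
  have jd : ((e m 3 + e m 4).+1 < d.+1)%N by lia.
  exists (inr (true, (Ordinal id, Ordinal jd))); apply: eqm.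
  rewrite /= ltnNge leq_addr m0 m1 m2 m5 m6 m7 m8.
  by congr [:: _; _; _; _; _; _; _; _; _; _]; lia.
- have m2 : e m 2 = 0%N by rewrite ms // sE.
  have m4 : e m 4 = 0%N by rewrite ms // sE.
  have m5 : e m 5 = 0%N by rewrite ms // sE.
  have m8 : e m 8 = 0%N by rewrite ms // sE.
  have m9 : e m 9 = 0%N by rewrite ms // sE.
  have [m6|m6] := posnP (e m 6); first exact: quad.
  have id : (e m 1 + e m 3 < d)%N by lia.
  have jd : (e m 1 < d.+1)%N by lia.
  exists (inr (false, (Ordinal id, Ordinal jd))); apply: eqm.
  rewrite /= leq_addr m0 m2 m4 m5 m7 m8 m9.
  by congr [:: _; _; _; _; _; _; _; _; _; _]; lia.
have m1 : e m 1 = 0%N by rewrite ms // sE.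
have m3 : e m 3 = 0%N by rewrite ms // sE.
have m5 : e m 5 = 0%N by rewrite ms // sE.
have m6 : e m 6 = 0%N by rewrite ms // sE.
have m9 : e m 9 = 0%N by rewrite ms // sE.
have [m8|m8] := posnP (e m 8); first exact: quad.
have id : (e m 2 < d)%N by lia.
have jd : ((e m 2 + e m 4).+1 < d.+1)%N by lia.
exists (inr (false, (Ordinal id, Ordinal jd))); apply: eqm.
rewrite /= ltnNge leq_addr m0 m1 m3 m5 m6 m7 m9.
by congr [:: _; _; _; _; _; _; _; _; _; _]; lia.
Qed.

Lemma card_basis_index d : #|{: basis_index d}| = (3 * d ^ 2 + 4 * d + 1)%N.
Proof. by rewrite card_sum !card_prod !card_ord card_bool; lia. Qed.

(** * The sextic surface and its Hilbert function *)

Section Hilbert.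
Variable K : numFieldType.
Local Notation X i := ('X_(inord i) : {mpoly K[10]}).

(** The section of the cone by the hyperplane z_0 = 0. *)
Definition sextic_surface : set 'rV[K]_10 :=
  [set v : 'rV[K]_10 | [/\ v != 0, z v 0 = 0 & cone_pt v]].

Local Notation J := (vanishing_ideal sextic_surface).

Lemma vanishing_idealD F G : J F -> J G -> J (F + G).
Proof.
move=> JF JG v Mv.
by rewrite /eval_at mevalD [Y in Y + _]JF // [Y in _ + Y]JG // addr0.
Qed.

Lemma vanishing_idealM F G : J G -> J (F * G).
Proof. by move=> JG v Mv; rewrite /eval_at mevalM [Y in _ * Y]JG // mulr0. Qed.

Lemma sextic_surface_normal_form F : exists R, J (F - R) /\
  forall m, m \in msupp R -> normal m /\ exists2 m0, m0 \in msupp F & mdeg m = mdeg m0.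
Proof.
apply: normal_form.
- by move=> v _; rewrite /eval_at meval0.
- exact: vanishing_idealD.
- exact: vanishing_idealM.
- by move=> v [_ _ [v7 _ _]]; rewrite /eval_at mevalXU.
- by move=> p pP v [_ _ [_ _ vd]]; rewrite /eval_at mevalM !mevalXU vd.
- by move=> v [_ _ [_ vq _]]; rewrite /eval_at mevalB !mevalM !mevalXU vq subrr.
Qed.

Lemma meval_supp_eq n (R : {mpoly K[n]}) (v w : 'I_n -> K) :
  (forall m, m \in msupp R -> forall i, m i != 0%N -> v i = w i) ->
  R.@[v] = R.@[w].
Proof.
move=> Rvw; rewrite !mevalE [LHS]big_seq [RHS]big_seq; apply: eq_bigr => m mR.
congr (_ * _); apply: eq_bigr => i _.
have [->|mi] := eqVneq (m i) 0%N; first by rewrite !expr0.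
by rewrite (Rvw m).
Qed.

(** A polynomial without z_0 takes the same value at a point of the cone and at
    its projection from P_5, so vanishing on the surface is vanishing on the
    cone. *)
Lemma normal_form_surface_eq0 (R : {mpoly K[10]}) :
  (forall m, m \in msupp R -> normal m /\ e m 0 = 0%N) -> J R -> R = 0.
Proof.
move=> nR JR; apply: normal_form_eq0 => [m /nR[]//|v cv [i i0 vi]].
pose w : 'rV[K]_10 := \row_j if j == 0 then 0 else v 0 j.
have wE k : (0 < k < 10)%N -> z w k = z v k.
  by case/andP=> k0 k10; rewrite mxE -val_eqE /= inordK //; case: k k0 {k10}.
have -> : eval_at R v = eval_at R w.
  apply: meval_supp_eq => m mR j mj; rewrite mxE; case: eqP => // jE.
  have [_ m0] := nR m mR; move: mj; rewrite jE.
  by rewrite (_ : 0 = inord 0) ?m0 //; apply: val_inj; rewrite /= inordK.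
apply: JR; split.
- by apply: contraNneq vi => /rowP/(_ i); rewrite !mxE (negPf i0) => ->.
- by rewrite mxE -val_eqE /= inordK.
case: cv => v7 vq vd; split; rewrite ?wE //.
move=> p pP; have /andP[p1 p2] : ((0 < p.1 < 10) && (0 < p.2 < 10))%N.
  by move: p pP; apply/allP.
by rewrite !wE // vd.
Qed.

(** The classes of the normal monomials of degree d without z_0 form a basis:
    they span by reduction to normal form, since z_0 vanishes on the surface, and
    they are independent by [normal_form_surface_eq0]. *)
Lemma hilbert_value_sextic_surface d :
  hilbert_value sextic_surface d #|{: basis_index d}|.
Proof.
pose mon (i : 'I_#|{: basis_index d}|) := basis_monomial (enum_val i).
have mon_inj : injective mon by move=> i j /basis_monomial_inj/enum_val_inj.
have sumE (c : 'I_#|{: basis_index d}| -> K) i :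
    (\sum_i c i *: 'X_[mon i] : {mpoly K[10]})@_(mon i) = c i.
  rewrite raddf_sum (bigD1 i) //= mcoeffZ mcoeffX eqxx mulr1 big1 ?addr0 // => j ji.
  by rewrite mcoeffZ mcoeffX (inj_eq mon_inj) (negPf ji) mulr0.
exists (fun i => 'X_[mon i]); split=> [i|F hF].
  by rewrite dhomogX /= basis_monomial_mdeg.
have [R [JR nR]] := sextic_surface_normal_form F.
have degR m : m \in msupp R -> mdeg m = d.
  by move=> /nR[_ [m0 m0F ->]]; apply: (dhomog_mf hF).
pose c := \row_i R@_(mon i).
have Jc : J (F - \sum_i c 0 i *: 'X_[mon i]).
  have -> : F - \sum_i c 0 i *: 'X_[mon i] = (F - R) + (R - \sum_i c 0 i *: 'X_[mon i]).
    by rewrite addrA subrK.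
  apply: vanishing_idealD => // v [_ v0 _].
  set D := R - _; have D0 (m : 'X_{1..10}) : e m 0 = 0%N -> D@_m = 0.
    move=> m0; rewrite /D mcoeffB.
    case: (pickP (fun i => m == mon i)) => [i /eqP mE|nomon].
      by rewrite mE sumE mxE subrr.
    rewrite raddf_sum big1 ?subr0 => [|i _]; last first.
      by rewrite /= mcoeffZ mcoeffX eq_sym nomon mulr0.
    apply/eqP; rewrite mcoeff_eq0; apply/negP => mR.
    have [nm _] := nR m mR; have [x xm] := basis_monomial_surj nm m0.
    have dm := degR m mR; subst d; have := nomon (enum_rank x).
    by rewrite /mon enum_rankK xm eqxx.
  rewrite /eval_at mevalE big_seq big1 // => m; rewrite mcoeff_msupp => mD.
  rewrite (bigD1 (inord 0)) //= v0 expr0n.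
  case: eqP => [/D0 Dm|]; last by rewrite mul0r mulr0.
  by rewrite Dm eqxx in mD.
exists c; split=> // c' Jc'; apply/rowP => i; apply/eqP; rewrite -subr_eq0.
pose N : {mpoly K[10]} := \sum_i (c 0 i - c' 0 i) *: 'X_[mon i].
suff N0 : N = 0 by rewrite -(sumE (fun i => c 0 i - c' 0 i)) -/N N0 mcoeff0.
apply: normal_form_surface_eq0 => [m|].
  move=> /msupp_sum_le/flattenP[s /mapP[j _ ->]] /msuppZ_le.
  by rewrite msuppX inE => /eqP ->; rewrite basis_monomial_normal basis_monomial0.
have -> : N = (F - \sum_i c' 0 i *: 'X_[mon i]) - (F - \sum_i c 0 i *: 'X_[mon i]).
  rewrite opprB addrC addrA subrK -sumrB; apply: eq_bigr => j _.
  by rewrite scalerBl.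
by apply: vanishing_idealD => //; rewrite -mulN1r; apply: vanishing_idealM.
Qed.

Lemma has_dim_degree_sextic_surface : has_dim_degree sextic_surface 2 6.
Proof.
pose P : {poly rat} := Poly [:: 1; 4%:R; 3%:R].
have PE : P = [:: 1; 4%:R; 3%:R] :> seq rat by rewrite (@PolyK _ 0).
exists P; rewrite /lead_coef PE; split=> //.
exists 0%N => d _; exists #|{: basis_index d}|; split; first exact: hilbert_value_sextic_surface.
rewrite card_basis_index /horner PE /= !natrD !natrM; ring.
Qed.

End Hilbert.

(** * Components of the sextic surface and the tangent cone *)

Section CoordinateSubspaces.
Variable K : numFieldType.
Implicit Types (v : 'rV[K]_10) (s t : seq nat).

Definition unit_row i : 'rV[K]_10 := delta_mx 0 (inord i).

Definition coord_space s : {vspace 'rV[K]_10} :=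
  <<[seq unit_row i | i <- s]>>%VS.

Lemma unit_rowE i j : (i < 10)%N -> (j < 10)%N -> z (unit_row i) j = (i == j)%:R.
Proof. by move=> i10 j10; rewrite mxE eqxx -val_eqE /= !inordK // eq_sym. Qed.

Lemma supported_unit_row s i : (i < 10)%N -> i \in s -> supported s (unit_row i).
Proof.
move=> i10 si j; rewrite mxE eqxx; case: eqP => // ->.
by rewrite inordK // si.
Qed.

Lemma mem_coord_space s v : all (gtn 10) s -> (v \in coord_space s) <-> supported s v.
Proof.
move=> /allP s10; split=> [vs j js|vs].
  rewrite (@coord_span _ _ _ (in_tuple [seq unit_row i | i <- s]) v vs).
  rewrite summxE big1 // => i _; rewrite mxE.
  have is_ : (i < size s)%N by rewrite -(size_map unit_row).
  have ms : nth 0%N s i \in s by apply: mem_nth.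
  by rewrite (nth_map 0%N) // (supported_unit_row (s10 _ ms) ms js) mulr0.
rewrite (row_sum_delta v) memv_suml // => j _.
have [js|/vs ->] := boolP ((j : nat) \in s); last by rewrite scale0r mem0v.
rewrite memvZ //; apply: memv_span; apply/mapP; exists (j : nat) => //.
by rewrite /unit_row inord_val.
Qed.

Lemma dim_coord_space s : all (gtn 10) s -> uniq s -> \dim (coord_space s) = size s.
Proof.
move=> /allP s10 us; have: free [seq unit_row i | i <- s].
  apply/(@freeP _ _ _ (in_tuple _)) => k k0 i.
  have is_ (j : 'I_(size [seq unit_row i | i <- s])) : (j < size s)%N.
    by rewrite -(size_map unit_row).
  have nth10 (j : 'I_(size [seq unit_row i | i <- s])) : (nth 0%N s j < 10)%N.
    by apply: s10; apply: mem_nth.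
  have /rowP/(_ (inord (nth 0%N s i))) := k0.
  rewrite summxE mxE (bigD1 i) //= big1 ?addr0 => [|j ji].
    by rewrite mxE (nth_map 0%N) // unit_rowE ?nth10 // eqxx mulr1.
  rewrite mxE (nth_map 0%N) // unit_rowE ?nth10 // nth_uniq //.
  by rewrite (inj_eq val_inj) (negPf ji) mulr0.
by rewrite /free size_map => /eqP.
Qed.

Lemma supportedI s t v :
  supported s v /\ supported t v <-> supported [seq i <- s | i \in t] v.
Proof.
split=> [[sv tv] i|stv].
  by rewrite mem_filter negb_and => /orP[/tv|/sv].
by split=> i si; apply: stv; rewrite mem_filter negb_and si ?orbT.
Qed.

Lemma coord_spaceI s t : all (gtn 10) s -> all (gtn 10) t ->
  (coord_space s :&: coord_space t)%VS = coord_space [seq i <- s | i \in t].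
Proof.
move=> s10 t10; have st10 : all (gtn 10) [seq i <- s | i \in t].
  by rewrite all_filter; apply: sub_all s10 => i /= ->; rewrite implybT.
apply/vspaceP => v; rewrite memv_cap; apply/andP/idP => [[vs vt]|vst].
  by apply/mem_coord_space => //; apply/supportedI; split; apply/mem_coord_space.
have /supportedI[vs vt] := iffLR (mem_coord_space v st10) vst.
by split; apply/mem_coord_space.
Qed.

Lemma coord_line_inj i j : coord_space [:: i] = coord_space [:: j] ->
  (i < 10)%N -> (j < 10)%N -> i = j.
Proof.
move=> ij i10 j10; apply/eqP/negPn/negP => nij.
have : unit_row i \in coord_space [:: i] by rewrite memv_span ?mem_head.
rewrite ij => /mem_coord_space; rewrite /= j10 => /(_ isT (inord i)).
rewrite inordK // inE nij => /(_ isT)/eqP.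
by rewrite unit_rowE // eqxx oner_eq0.
Qed.

Lemma plinear_coord_space s v : all (gtn 10) s ->
  plinear (coord_space s) v <-> v != 0 /\ supported s v.
Proof. by move=> s10; split=> -[v0 /mem_coord_space vs]; split=> //; apply: vs. Qed.

Lemma unit_row_neq0 i : (i < 10)%N -> unit_row i != 0.
Proof.
move=> i10; apply/eqP => /rowP/(_ (inord i)); rewrite unit_rowE // mxE eqxx.
by move/eqP; rewrite oner_eq0.
Qed.

End CoordinateSubspaces.

Section SexticSurface.
Variable K : numFieldType.
Local Notation X i := ('X_(inord i) : {mpoly K[10]}).
Local Notation M6 := (@sextic_surface K).

Lemma supported_cons0 s (v : 'rV[K]_10) : z v 0 = 0 ->
  supported (0%N :: s) v -> supported s v.
Proof.
move=> v0 sv i si; have [i0|i0] := eqVneq (i : nat) 0%N.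
  by rewrite -(inord_val i) i0.
by apply: sv; rewrite in_cons negb_or i0.
Qed.

Lemma supported_sub s t (v : 'rV[K]_10) : {subset s <= t} ->
  supported s v -> supported t v.
Proof. by move=> st sv i it; apply: sv; apply: contra it => /st. Qed.

Lemma cone_pt_agree (v w : 'rV[K]_10) :
  (forall i, (0 < i < 10)%N -> z v i = z w i) -> cone_pt v -> cone_pt w.
Proof.
move=> vw [v7 vq vd]; split; rewrite -?vw //.
move=> p pP; have /andP[p1 p2] : ((0 < p.1 < 10) && (0 < p.2 < 10))%N.
  by move: p pP; apply/allP.
by rewrite -!vw // vd.
Qed.

Lemma cone_ptZ c (v : 'rV[K]_10) : cone_pt v -> cone_pt (c *: v).
Proof.
move=> [v7 vq vd]; split; rewrite ?mxE ?v7 ?mulr0 //.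
  by rewrite mulrACA vq; ring.
by move=> p /vd pv; rewrite !mxE mulrACA pv mulr0.
Qed.

Lemma sextic_surface_unit_row i : (0 < i < 10)%N -> i != 7 -> M6 (unit_row K i).
Proof.
case/andP=> i0 i10 i7.
have uE j := unit_rowE K i10 (j := j).
split; rewrite ?unit_row_neq0 ?uE //; first by case: i i0 {i10 i7 uE}.
split; rewrite ?uE ?(negPf i7) //.
  rewrite -!natrM; congr _%:R; do 2!(case: eqP => //=; try lia).
move=> p pP; have /andP[p1 p2] := zero_pairs_lt10 pP.
have p12 : p.1 != p.2 by move: p pP {p1 p2}; apply/allP.
by rewrite !uE // -natrM mulnb; case: (i =P p.1) => // ->; rewrite (negPf p12).
Qed.

Lemma cone_over_sextic_surface (v : 'rV[K]_10) :
  cone_over M6 (P5 K) v <-> v != 0 /\ cone_pt v.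
Proof.
split=> [[v0 [x [[_ _ cx] [s [t vE]]]]]|[v0 cv]]; split=> //.
  apply: cone_pt_agree (cone_ptZ t cx) => i i0.
  rewrite vE !mxE -!val_eqE /= inordK; last by case/andP: i0.
  by case: i i0 => // i _; rewrite mulr0 add0r.
pose w : 'rV[K]_10 := \row_j if j == 0 then 0 else v 0 j.
have wE k : (0 < k < 10)%N -> z w k = z v k.
  by case/andP=> k0 k10; rewrite mxE -val_eqE /= inordK //; case: k k0 {k10}.
have w0 : z w 0 = 0 by rewrite mxE -val_eqE /= inordK.
have vw : v = z v 0 *: P5 K + w.
  apply/rowP => j; rewrite !mxE eqxx /=; case: eqP => [->|]; last by rewrite mulr0 add0r.
  by rewrite mulr1 addr0; congr (v 0 _); apply: val_inj; rewrite /= inordK.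
have [wz|wz] := eqVneq w 0.
  exists (unit_row K 1); split; first exact: sextic_surface_unit_row.
  by exists (z v 0), 0; rewrite scale0r {1}vw wz.
exists w; split; last by exists (z v 0), 1; rewrite scale1r.
by split=> //; apply: cone_pt_agree cv => i /wE.
Qed.

Lemma zariski_closed_hyperplane i :
  zariski_closed [set v : 'rV[K]_10 | v != 0 /\ z v i = 0].
Proof.
apply/seteqP; split=> v; last by move=> [v0 vi]; split=> // F [FX _]; apply: FX.
move=> [v0 Fv]; split=> //.
have := Fv (X i); rewrite /eval_at mevalXU; apply; split; last first.
  by exists 1%N; apply: dhomog_var.
by move=> w [_ wi]; rewrite /eval_at mevalXU.
Qed.

Lemma zariski_closed_sextic_surface : zariski_closed M6.
Proof.
apply/seteqP; split=> v; last by move=> Mv; split=> [|F [FX _]]; [case: Mv|apply: FX].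
move=> [v0 Fv].
have eqn d (F : {mpoly K[10]}) : F \is d.-homog ->
    (forall w, M6 w -> eval_at F w = 0) -> eval_at F v = 0.
  by move=> hF FM; apply: Fv; split=> //; exists d.
split=> //; last split.
- have := eqn 1%N _ (dhomog_var K 0); rewrite /eval_at !mevalXU; apply.
  by move=> w [_ w0 _]; rewrite mevalXU.
- have := eqn 1%N _ (dhomog_var K 7); rewrite /eval_at !mevalXU; apply.
  by move=> w [_ _ [w7 _ _]]; rewrite mevalXU.
- apply/eqP; rewrite -subr_eq0; apply/eqP.
  have := eqn 2%N (X 1 * X 4 - X 2 * X 3).
  rewrite /eval_at mevalB !mevalM !mevalXU; apply.
    by rewrite rpredB ?dhomog_var2.
  by move=> w [_ _ [_ wq _]]; rewrite mevalB !mevalM !mevalXU wq subrr.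
move=> p pP; have := eqn 2%N _ (dhomog_var2 K p.1 p.2).
rewrite /eval_at mevalM !mevalXU; apply.
by move=> w [_ _ [_ _ wd]]; rewrite mevalM !mevalXU wd.
Qed.

(** z_5 z_9 vanishes on the surface, but neither factor does. *)
Lemma sextic_surface_reducible : ~ zariski_irreducible M6.
Proof.
move=> [_ irr]; have [v [v0 _ [_ _ vd]]|sub|sub] := irr _ _
  (zariski_closed_hyperplane 5) (zariski_closed_hyperplane 9).
- have /eqP := vd (5, 9)%N isT; rewrite mulf_eq0 => /orP[]/eqP vi; [left|right] => //.
- have [_ /eqP] := sub _ (sextic_surface_unit_row (i := 5) isT isT).
  by rewrite unit_rowE // oner_eq0.
- have [_ /eqP] := sub _ (sextic_surface_unit_row (i := 9) isT isT).
  by rewrite unit_rowE // oner_eq0.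
Qed.

Definition segre_quadric : set 'rV[K]_10 :=
  plinear (coord_space K [:: 1; 2; 3; 4]%N)
  `&` [set v | eval_at (X 1 * X 4 - X 2 * X 3) v = 0].

Lemma segre_quadricP v : segre_quadric v <->
  [/\ v != 0, supported [:: 1; 2; 3; 4]%N v & z v 1 * z v 4 = z v 2 * z v 3].
Proof.
rewrite /segre_quadric /setI /= /eval_at mevalB !mevalM !mevalXU.
split=> [[/plinear_coord_space[//|v0 vs] /eqP]|[v0 vs vq]].
  by rewrite subr_eq0 => /eqP.
by split; [apply/plinear_coord_space|rewrite vq subrr].
Qed.

Lemma zariski_closed_separation n (Y : set 'rV[K]_n.+1) y :
  zariski_closed Y -> y != 0 -> ~ Y y ->
  exists2 F, vanishing_ideal Y F & eval_at F y != 0.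
Proof.
move=> Yc y0 nYy; apply: boolp.contrapT => nF; apply: nYy; rewrite -Yc.
split=> // F [FY _]; apply/eqP/negPn/negP => Fy; apply: nF.
by exists F.
Qed.

Lemma segre_quadric_param v : segre_quadric v -> exists p0 p1 p2 p3,
  (fun i => v 0 i) =1
  coords [:: 0; p1 * p2; p1 * p3; p0 * p2; p0 * p3; 0; 0; 0; 0; 0].
Proof.
move=> /segre_quadricP[_ sv /segre_param[p0 [p1 [p2 [p3 [e1 e2 e3 e4]]]]]].
exists p0, p1, p2, p3 => i; rewrite (supported_coords sv) /=.
by rewrite e1 e2 e3 e4.
Qed.

(** If the closed sets Y and Z cover the quadric but neither contains it, take a
    point y off Y, a point w off Z and forms F, G separating them. Joining the
    parameters of y and w in P^1 x P^1 by a line gives a rational curve on the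
    quadric through y and w, on which F G vanishes although neither F nor G
    does. *)
Lemma segre_quadric_irreducible : zariski_irreducible segre_quadric.
Proof.
split.
  exists (unit_row K 1); apply/segre_quadricP; split.
  - exact: unit_row_neq0.
  - exact: supported_unit_row.
  - by rewrite !unit_rowE // !mulr0.
move=> Y Z Yc Zc QYZ.
have [|/nonsubset[y [Qy nYy]]] := boolp.EM (segre_quadric `<=` Y); first by left.
have [|/nonsubset[w [Qw nZw]]] := boolp.EM (segre_quadric `<=` Z); first by right.
have [y0 _ _] := iffLR (segre_quadricP y) Qy.
have [w0 _ _] := iffLR (segre_quadricP w) Qw.
have [F FY Fy] := zariski_closed_separation Yc y0 nYy.
have [G GZ Gw] := zariski_closed_separation Zc w0 nZw.
have [p0 [p1 [p2 [p3 yE]]]] := segre_quadric_param Qy.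
have [r0 [r1 [r2 [r3 wE]]]] := segre_quadric_param Qw.
pose line (u v : K) : {poly K} := u%:P + (v - u) *: 'X.
have lineE u v x : (line u v).[x] = u + (v - u) * x.
  by rewrite /line hornerD hornerC hornerZ hornerX.
pose W : seq {poly K} := [:: 0; line p1 r1 * line p2 r2; line p1 r1 * line p3 r3;
  line p0 r0 * line p2 r2; line p0 r0 * line p3 r3; 0; 0; 0; 0; 0].
pose curve x : 'rV[K]_10 := \row_i (W`_i).[x].
have curveE x : (fun i => curve x 0 i) =1 (fun i : 'I_10 => (W`_i).[x]).
  by move=> i; rewrite mxE.
have curve0 : curve 0 = y.
  apply/rowP; apply: ord10_ind; rewrite curveE yE /coords !inordK //= ?horner0 //;
  by rewrite hornerM !lineE !mulr0 !addr0.
have curve1 : curve 1 = w.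
  apply/rowP; apply: ord10_ind; rewrite curveE wE /coords !inordK //= ?horner0 //;
  by rewrite hornerM !lineE !mulr1 !subrKC.
have Qcurve x : curve x != 0 -> segre_quadric (curve x).
  move=> cx0; apply/segre_quadricP; split=> //.
    by apply: ord10_ind; rewrite inordK // mxE inordK //= horner0.
  by rewrite !mxE !inordK //= !hornerM; ring.
have evalE H x : (curve_eval (fun i : 'I_10 => W`_i) H).[x] = eval_at H (curve x).
  by rewrite horner_curve /eval_at; apply: meval_eq => i; rewrite curveE.
have [k yk] : exists k, y 0 k != 0 by apply/rV0Pn.
pose PF := curve_eval (fun i : 'I_10 => W`_i) F.
pose PG := curve_eval (fun i : 'I_10 => W`_i) G.
have : PF * PG * W`_k != 0.
  rewrite !mulf_neq0 //.
  - apply: contraNneq Fy => /(congr1 (horner^~ 0)) /=.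
    by rewrite evalE curve0 horner0 => ->.
  - apply: contraNneq Gw => /(congr1 (horner^~ 1)) /=.
    by rewrite evalE curve1 horner0 => ->.
  - by apply: contraNneq yk => Wk; rewrite -curve0 curveE Wk horner0.
move=> /exists_nonroot[x]; rewrite !hornerM !evalE !mulf_eq0 !negb_or -andbA.
move=> /and3P[Fx Gx Wx].
have /QYZ[/FY/eqP|/GZ/eqP] : segre_quadric (curve x).
- by apply: Qcurve; apply: contraNneq Wx => /rowP/(_ k); rewrite !mxE => ->.
- by rewrite (negPf Fx).
- by rewrite (negPf Gx).
Qed.

Lemma sextic_surface_components : M6 =
  plinear (coord_space K [:: 1; 2; 5]%N) `|` plinear (coord_space K [:: 1; 3; 6]%N)
  `|` plinear (coord_space K [:: 3; 4; 9]%N)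
  `|` plinear (coord_space K [:: 2; 4; 8]%N) `|` segre_quadric.
Proof.
have offv0 s (v : 'rV[K]_10) : all (fun i => 0 < i)%N s -> supported s v -> z v 0 = 0.
  move=> /allP s0 sv; apply: supportedE sv _ _ => //.
  by apply/negP => /s0.
have onplane s v : (0%N :: s) \in plane_supports -> v != 0 -> supported s v ->
    all (fun i => 0 < i)%N s -> M6 v.
  move=> sP v0 sv s0; split=> //; first exact: offv0 sv.
  by apply: cone_pt_plane sP _; apply: supported_sub sv => i si; rewrite in_cons si orbT.
apply/seteqP; split=> v.
  move=> [v0 vz /cone_ptP[[s sP sv]|[sv vq]]]; last first.
    by right; apply/segre_quadricP; split=> //; apply: supported_cons0.
  left; move: sP; rewrite !inE => /or4P[]/eqP sE; rewrite sE in sv;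
    have {}sv := supported_cons0 vz sv.
  - by left; left; left; apply/plinear_coord_space.
  - by left; right; apply/plinear_coord_space.
  - by left; left; right; apply/plinear_coord_space.
  - by right; apply/plinear_coord_space.
move=> [[[[]|]|]|]; try by move=> /plinear_coord_space[//|v0 sv]; apply: onplane sv _.
move=> /segre_quadricP[v0 sv vq]; split=> //; first exact: offv0 sv.
apply: cone_pt_quadric vq; apply: supported_sub sv => i si.
by rewrite in_cons si orbT.
Qed.

Lemma plane_quadric s t : all (gtn 10) s ->
  t = [seq i <- s | i \in [:: 1; 2; 3; 4]%N] ->
  (forall v : 'rV[K]_10, supported t v -> z v 1 * z v 4 = z v 2 * z v 3) ->
  plinear (coord_space K s) `&` segre_quadric = plinear (coord_space K t).
Proof.
move=> s10 tE tq; have t10 : all (gtn 10) t.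
  by rewrite tE all_filter; apply: sub_all s10 => i /= ->; rewrite implybT.
apply/seteqP; split=> v.
  move=> [/plinear_coord_space[//|v0 sv] /segre_quadricP[_ qv vq]].
  by apply/plinear_coord_space => //; split=> //; rewrite tE; apply/supportedI.
move=> /plinear_coord_space[//|v0 tv]; have vq := tq v tv.
have [sv qv] : supported s v /\ supported [:: 1; 2; 3; 4]%N v.
  by apply/supportedI; rewrite -tE.
by split; [apply/plinear_coord_space|apply/segre_quadricP].
Qed.

End SexticSurface.

Section TangentConeOfKLM.
Variables (K : numFieldType) (a : 'rV[K]_14).
Local Notation al i := (a 0 (inord i)).
Hypotheses (a0 : al 0 != 0) (a1 : al 1 != 0) (a3 : al 3 != 0) (a4 : al 4 != 0).
Local Notation M6 := (@sextic_surface K).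
Local Notation TI := (tangent_cone_ideal (W_KLM9 a) (P5 K)).

(** The initial forms vanish on the cone by the arcs. Conversely, the normal
    form modulo the ideal of the tangent cone of a polynomial vanishing on the
    cone still vanishes there, hence is zero. *)
Lemma tangent_cone_ideal_eq : TI = vanishing_ideal (cone_over M6 (P5 K)).
Proof.
have sub F : TI F -> vanishing_ideal (cone_over M6 (P5 K)) F.
  move=> TF v /cone_over_sextic_surface[_]; exact: (tangent_cone_ideal_cone a0 a1 a3 a4).
apply/seteqP; split=> // F FM.
have [R [JR nR]] : exists R, TI (F - R) /\ forall m, m \in msupp R ->
    normal m /\ exists2 m0, m0 \in msupp F & mdeg m = mdeg m0.
  apply: normal_form.
  - exact: ideal_generated0.
  - exact: ideal_generatedD.
  - exact: ideal_generatedM.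
  - exact: tangent_cone_X7.
  - by move=> [i j]; apply: tangent_cone_zero_pair.
  - exact: tangent_cone_quadric.
suff R0 : R = 0 by rewrite R0 subr0 in JR.
apply: normal_form_eq0 => [m /nR[]//|v cv [i _ vi]].
have Mv : cone_over M6 (P5 K) v.
  apply/cone_over_sextic_surface; split=> //.
  by apply: contraNneq vi => ->; rewrite mxE.
have := sub _ JR v Mv; rewrite /eval_at mevalB [Y in Y - _]FM // sub0r.
by move/eqP; rewrite oppr_eq0 => /eqP.
Qed.

Lemma tangent_cone_eq : tangent_cone (W_KLM9 a) (P5 K) = cone_over M6 (P5 K).
Proof.
rewrite /tangent_cone; apply/seteqP; split=> v.
  move=> [v0 Iv]; apply/cone_over_sextic_surface; split=> //; split.
  - by have := Iv _ (tangent_cone_X7 a); rewrite /eval_at mevalXU.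
  - have := Iv _ (tangent_cone_quadric a); rewrite /eval_at mevalB !mevalM !mevalXU.
    by move/eqP; rewrite subr_eq0 => /eqP.
  - move=> [i j] /(tangent_cone_zero_pair a)/Iv.
    by rewrite /eval_at mevalM !mevalXU.
move=> Mv; split; first by have /cone_over_sextic_surface[] := Mv.
by move=> F; rewrite tangent_cone_ideal_eq; apply.
Qed.

End TangentConeOfKLM.

Lemma quadric_surface_segre (K : numFieldType) :
  quadric_surface_in (coord_space K [:: 1; 2; 3; 4]%N) (@segre_quadric K).
Proof.
split; first by rewrite dim_coord_space.
exists ('X_(inord 1) * 'X_(inord 4) - 'X_(inord 2) * 'X_(inord 3)); split=> //.
  by rewrite rpredB ?dhomog_var2.
exists (unit_row K 1 + unit_row K 4).
  by rewrite memvD // memv_span // map_f.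
rewrite /eval_at mevalB !mevalM !mevalXU.
rewrite ![(unit_row K 1 + _) _ _]mxE !unit_rowE //=.
by rewrite !(addr0, add0r, mulr0, mulr1, subr0) oner_eq0.
Qed.

Theorem theorem10p3 (R : realType) (a : 'rV[R[i]]_14)
    (ha0 : a 0 (inord 0) = 1)
    (ha : forall k : 'I_14,
       (k : nat) \in [:: 1; 3; 4; 9; 10; 12; 13]%N -> a 0 k != 0) :
  exists (M6 Q : set 'rV[R[i]]_10)
         (Pi7 Pi3 pi1 pi2 pi1' pi2' l1 l2 l1' l2' : {vspace 'rV[R[i]]_10}),
  (* the tangent cone is a cone over M6, set-theoretically and as a scheme *)
  (tangent_cone (W_KLM9 a) (P5 _) = cone_over M6 (P5 _) /\
   tangent_cone_ideal (W_KLM9 a) (P5 _) =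
     vanishing_ideal (cone_over M6 (P5 _))) /\
  (* M6 is a reducible sextic surface in a P^7 not containing the vertex *)
  [/\ \dim Pi7 = 8%N, P5 _ \notin Pi7 & M6 `<=` plinear Pi7] /\
  [/\ zariski_closed M6, ~ zariski_irreducible M6 & has_dim_degree M6 2 6] /\
  (* M6 is the union of four planes and of a quadric surface in a P^3 *)
  M6 = plinear pi1 `|` plinear pi2 `|` plinear pi1' `|` plinear pi2' `|` Q /\
  [/\ \dim pi1 = 3%N, \dim pi2 = 3%N, \dim pi1' = 3%N & \dim pi2' = 3%N] /\
  [/\ (Pi3 <= Pi7)%VS, quadric_surface_in Pi3 Q & zariski_irreducible Q] /\
  (* the planes intersect Q along lines *)
  [/\ \dim l1 = 2%N, \dim l2 = 2%N, \dim l1' = 2%N & \dim l2' = 2%N] /\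
  [/\ plinear pi1 `&` Q = plinear l1, plinear pi2 `&` Q = plinear l2,
      plinear pi1' `&` Q = plinear l1' & plinear pi2' `&` Q = plinear l2'] /\
  (* l_i is disjoint from l_i' *)
  (plinear l1 `&` plinear l1' = set0 /\ plinear l2 `&` plinear l2' = set0) /\
  (* the other pairs of lines intersect in four distinct points *)
  let q12 := (l1 :&: l2)%VS in let q12' := (l1 :&: l2')%VS in
  let q1'2 := (l1' :&: l2)%VS in let q1'2' := (l1' :&: l2')%VS in
  [/\ \dim q12 = 1%N, \dim q12' = 1%N, \dim q1'2 = 1%N & \dim q1'2' = 1%N] /\
  uniq [:: q12; q12'; q1'2; q1'2'].
Proof.
have al0 : a 0 (inord 0) != 0 by rewrite ha0 oner_eq0.
have al1 : a 0 (inord 1) != 0 by apply: ha; rewrite inordK.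
have al3 : a 0 (inord 3) != 0 by apply: ha; rewrite inordK.
have al4 : a 0 (inord 4) != 0 by apply: ha; rewrite inordK.
pose S s := coord_space R[i] s.
exists (@sextic_surface R[i]), (@segre_quadric R[i]).
exists (S [:: 1; 2; 3; 4; 5; 6; 8; 9]%N), (S [:: 1; 2; 3; 4]%N).
exists (S [:: 1; 2; 5]%N), (S [:: 1; 3; 6]%N), (S [:: 3; 4; 9]%N), (S [:: 2; 4; 8]%N).
exists (S [:: 1; 2]%N), (S [:: 1; 3]%N), (S [:: 3; 4]%N), (S [:: 2; 4]%N).
split; first by split; [exact: tangent_cone_eq|exact: tangent_cone_ideal_eq].
split.
  split; first by rewrite dim_coord_space.
    apply/negP => /mem_coord_space => /(_ isT (inord 0)).
    by rewrite mxE -!val_eqE /= !inordK //= => /(_ isT)/eqP; rewrite oner_eq0.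
  move=> v Mv; have [v0 vz [v7 _ _]] := Mv; apply/plinear_coord_space => //; split=> //.
  apply: ord10_ind; rewrite inordK //.
split.
  split; [exact: zariski_closed_sextic_surface|exact: sextic_surface_reducible|].
  exact: has_dim_degree_sextic_surface.
split; first exact: sextic_surface_components.
split; first by split; rewrite dim_coord_space.
split.
  split; [|exact: quadric_surface_segre|exact: segre_quadric_irreducible].
  apply/subvP => v /mem_coord_space => /(_ isT) sv.
  by apply/mem_coord_space => //; apply: supported_sub sv; apply/allP.
split; first by split; rewrite dim_coord_space.
split.
  split; apply: plane_quadric => // v /supportedE sv.
  - by rewrite (sv 3)%N // (sv 4)%N // !mulr0.
  - by rewrite (sv 2)%N // (sv 4)%N // mulr0 mul0r.
  - by rewrite (sv 1)%N // (sv 2)%N // !mul0r.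
  - by rewrite (sv 1)%N // (sv 3)%N // mulr0 mul0r.
split.
  have disj s t : all (gtn 10) s -> all (gtn 10) t -> [seq i <- s | i \in t] = [::] ->
      plinear (S s) `&` plinear (S t) = set0.
    move=> s10 t10 st; apply/seteqP; split=> // v.
    move=> [/plinear_coord_space[//|v0 sv] /plinear_coord_space[//|_ tv]].
    have := iffLR (supportedI s t v) (conj sv tv); rewrite st => nv.
    by case/eqP: v0; apply/rowP => i; rewrite mxE nv.
  by split; apply: disj.
rewrite /S !coord_spaceI //=; split; first by split; rewrite dim_coord_space.
rewrite /= !inE !negb_or !andbT.
by do !(apply/andP; split) => //; apply/eqP => /coord_line_inj/(_ isT isT).
Qed.
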